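(* For an upper triangular matrix $A$ the following are equivalent: (a) $\sum_{j,m}|a_{j,m}b_{j,m}|<\infty$ for every Toeplitz matrix $B\in\mathcal{B}(D,\ell_2)$; (b) $A\in\mathcal{M}_{S_1}(2,1)$. Moreover there are absolute constants $c,C\in(0,\infty)$ such that $c\,\|A\|_{\mathcal{M}_{S_1}(2,1)}\le\sigma(A)\le C\,\|A\|_{\mathcal{M}_{S_1}(2,1)}$ for every upper triangular matrix $A$, where $$\sigma(A):=\sup\Bigl\{\sum_{k\ge0}\|A_k\|_{S_1}\,|\widehat f(k)|:\ f\in\mathcal{B},\ \|f\|_{\mathcal{B}}\le1\Bigr\}.$$
   Context: All matrices are infinite complex matrices $A=(a_{j,m})_{j,m\ge1}$, upper triangular: $a_{j,m}=0$ for $m<j$. For $k\ge0$ the $k$-th diagonal $A_k$ is the matrix agreeing with $A$ on the entries $(l,l+k)$, $l\ge1$, and vanishing elsewhere; write $a_k^{\,l}:=a_{l,l+k}$. Put $\|A_k\|_{S_1}=\sum_l|a_k^{\,l}|\in[0,\infty]$ and $\|A_k\|_{B(\ell_2)}=\sup_l|a_k^{\,l}|$. An (upper triangular) matrix is Toeplitz if $a_k^{\,l}$ does not depend on $l$, for each $k\ge0$. Dyadic blocks: $I_0=\{0,1\}$ and $I_n=\{k:2^n\le k<2^{n+1}\}$ for $n\ge1$. Put $\|A\|_{\mathcal{M}_{S_1}(2,1)}=\sum_{n\ge0}\bigl(\sum_{k\in I_n}\|A_k\|_{S_1}^2\bigr)^{1/2}\in[0,\infty]$, and let $\mathcal{M}_{S_1}(2,1)$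 be the space of upper triangular $A$ for which this is finite. Matricial Bloch space: for $0\le r<1$ let $A'(r)=\sum_{k\ge1}kA_kr^{k-1}$ (entrywise), required to define a bounded operator on $\ell_2$ for each $r$. $\mathcal{B}(D,\ell_2)$ is the space of upper triangular $A$ with $\|A\|_{\mathcal{B}(D,\ell_2)}:=\sup_{0\le r<1}(1-r^2)\|A'(r)\|_{B(\ell_2)}+\|A_0\|_{B(\ell_2)}<\infty$. The scalar Bloch space $\mathcal{B}$ consists of the analytic $f(z)=\sum_{k\ge0}\widehat f(k)z^k$ on the unit disc $D$ with $\|f\|_{\mathcal{B}}=\sup_{|z|<1}(1-|z|^2)|f'(z)|+|f(0)|<\infty$. The convention $\infty\cdot0=0$ is used in $\sigma(A)$; $\sigma(A)$ takes values in $[0,\infty]$. *)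

(* Defs.v *)
From mathcomp Require Import all_boot all_order all_algebra.
From mathcomp Require Import complex.
From mathcomp Require Import all_classical all_reals all_analysis.

Set Implicit Arguments.
Unset Strict Implicit.
Unset Printing Implicit Defensive.

Import Order.TTheory GRing.Theory Num.Theory.
Import numFieldNormedType.Exports.
Import ComplexField.Normc.

Local Open Scope classical_set_scope.
Local Open Scope ring_scope.

Section Matrices.
Variable R : realType.
Local Notation C := R[i].

(* Rows, columns and positions along a diagonal are numbered from 0, so that
   [A l (l + k)] is the entry a_k^{l+1} of the k-th diagonal. *)
Definition imatrix := nat -> nat -> C.
Implicit Types A B : imatrix.

Definition upper_triangular A := forall j m, (m < j)%N -> A j m = 0.

Definition diag A (k : nat) : imatrix :=
  fun j m => if m == (j + k)%N then A j m else 0.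

Definition toeplitz A :=
  upper_triangular A /\ forall k l l', A l (l + k)%N = A l' (l' + k)%N.

Definition diagS1 A (k : nat) : \bar R :=
  (\sum_(0 <= l <oo) (normc (A l (l + k)%N))%:E)%E.

Definition diagB A (k : nat) : \bar R :=
  ereal_sup [set (normc (A l (l + k)%N))%:E | l in [set: nat]].

Definition dyadic (n : nat) : seq nat :=
  if n is 0%N then [:: 0%N; 1%N] else index_iota (2 ^ n) (2 ^ n.+1).

Definition MS1_norm A : \bar R :=
  (\sum_(0 <= n <oo) sqrte (\sum_(k <- dyadic n) diagS1 A k ^+ 2))%E.

Definition MS1 A := upper_triangular A /\ (MS1_norm A < +oo)%E.

Definition l2norm (x : nat -> C) : \bar R :=
  sqrte (\sum_(0 <= m <oo) (normc (x m) ^+ 2)%:E)%E.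

(* The regular module R[i]^o carries the norm topology of the complex field and
   its normed space structure over itself: limits of series and complex
   derivatives are taken in it. *)
Definition mxapply A (x : nat -> C) : nat -> C :=
  fun j => limn (series (fun m => A j m * x m : R[i]^o)).

(* [A] defines a bounded operator on l_2: the row series converge for every
   x in l_2 and x |-> A x is bounded from l_2 to l_2. *)
Definition bounded_l2 A := exists M : R,
  forall x : nat -> C, (l2norm x < +oo)%E ->
    (forall j, cvgn (series (fun m => A j m * x m : R[i]^o))) /\
    (l2norm (mxapply A x) <= M%:E * l2norm x)%E.

(* Only meaningful when [bounded_l2 A]. *)
Definition opnorm A : \bar R :=
  ereal_sup [set l2norm (mxapply A x) | x in [set x | (l2norm x <= 1)%E]].

(* The entrywise series A'(r) = \sum_(k >= 1) k A_k r^(k-1); the (j, m) entry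
   of A_k is 0 for k > m, so that only finitely many terms contribute. *)
Definition mxderiv A (r : R) : imatrix :=
  fun j m => \sum_(1 <= k < m.+1) k%:R * diag A k j m * (r%:C)%C ^+ k.-1.

Definition mxbloch_norm A : \bar R :=
  (ereal_sup [set ((1 - r ^+ 2)%:E * opnorm (mxderiv A r))
             | r in [set r : R | (0 <= r < 1)%R]]
   + diagB A 0)%E.

Definition mxbloch A :=
  [/\ upper_triangular A,
      forall r : R, 0 <= r < 1 -> bounded_l2 (mxderiv A r)
    & (mxbloch_norm A < +oo)%E].

(* [f] is analytic on the unit disc with Taylor coefficients [a] at 0; the
   values of [f] outside the disc are irrelevant. *)
Definition taylor_disc (f : C -> R[i]^o) (a : nat -> C) :=
  forall z : C, normc z < 1 ->
    series (fun k => a k * z ^+ k : R[i]^o) @ \oo --> f z.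

Definition bloch_norm (f : C -> R[i]^o) : \bar R :=
  (ereal_sup [set ((1 - normc z ^+ 2) * normc (f^`()%classic z))%:E
             | z in [set z : C | (normc z < 1)%R]]
   + (normc (f 0))%:E)%E.

(* The convention +oo * 0 = 0 is that of the product of [\bar R]. *)
Definition sigma A : \bar R :=
  ereal_sup [set s | exists f a,
    [/\ taylor_disc f a, (bloch_norm f <= 1)%E
      & s = (\sum_(0 <= k <oo) (diagS1 A k * (normc (a k))%:E))%E]].

End Matrices.

(* Main.v *)
(** A Toeplitz matrix with symbol [f] lies in the matricial Bloch space exactly
    when [f] is a Bloch function, so everything reduces to identifying the Köthe
    dual of the coefficient sequences of Bloch functions, weighted by
    [lam k = ||A_k||_(S_1)], with the mixed-norm space [l(2,1)].

    Upper bound: the columns of [B'(r)] (for matrices), respectively Parseval's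
    identity on the circle of radius [r] (for functions), with
    [1 - r = 2^-(n+1)], bound the l_2 norm of the coefficients in each dyadic
    block by [8 K]; Cauchy-Schwarz on each block concludes.

    Lower bound: on a block [q + q <= k < 4 * q], [q = 2^n], Khinchine's
    inequality yields signs [e k] for which [h = \sum_k e_k lam_k z^k] has a
    discrete L1 norm, over the [2q]-th roots of unity, at least half its l_2
    norm. The phase [g] of [h] is bounded by 1, and its discrete Fourier
    coefficients, multiplied by a Fejér kernel of width [2q] centered at [3q],
    are those of a polynomial with spectrum in [(q, 5q)]; its Toeplitz matrix is
    bounded because the Fejér weights split as a product over windows of length
    [2q]. Differentiation costs a factor [5 q r^q], and summing over the blocks
    of one residue class mod 3, which have disjoint spectra, gives a Bloch
    sequence pairing with [lam] at least as a quarter of the norms of these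
    blocks. *)

Require Import Defs.
From mathcomp Require Import all_boot all_order all_algebra.
From mathcomp Require Import complex.
From mathcomp Require Import all_classical all_reals all_analysis.
From mathcomp Require Import cyclic separable cyclotomic.
From mathcomp Require Import zify ring lra.

Import Order.TTheory GRing.Theory Num.Theory.
Import numFieldNormedType.Exports.
Import ComplexField.Normc.

Local Open Scope classical_set_scope.
Local Open Scope ring_scope.
Set Implicit Arguments.
Unset Strict Implicit.
Unset Printing Implicit Defensive.

(** * Complex moduli and roots of unity *)

Section ComplexModulus.
Variable R : realType.
Local Notation C := R[i].
Implicit Types z w : C.
Local Notation Re := complex.Re.
Local Notation Im := complex.Im.

Lemma normc_ge0 z : 0 <= normc z.
Proof. by case: z => x y /=; exact: sqrtr_ge0. Qed.

Lemma sqr_normcE z : normc z ^+ 2 = Re z ^+ 2 + Im z ^+ 2.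
Proof. by case: z => x y /=; rewrite sqr_sqrtr ?addr_ge0 ?sqr_ge0. Qed.

Lemma sqr_normcJ z : ((normc z ^+ 2)%:C)%C = z * (z^*)%C.
Proof.
rewrite sqr_normcE; case: z => x y; apply/eqP; rewrite eq_complex /=.
by apply/andP; split; apply/eqP; ring.
Qed.

Lemma normc_conj z : normc (z^*)%C = normc z.
Proof. by case: z => x y /=; rewrite sqrrN. Qed.

Lemma normc_real (x : R) : normc (x%:C)%C = `|x|.
Proof. by rewrite /= expr0n addr0 sqrtr_sqr. Qed.

Lemma normc_nat n : normc (n%:R : C) = n%:R.
Proof. by rewrite -(rmorph_nat (real_complex R)) normc_real normr_nat. Qed.

Lemma normcX z n : normc (z ^+ n) = normc z ^+ n.
Proof.
by elim: n => [|n IH]; rewrite ?expr0 ?normc1// !exprS normcM IH.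
Qed.

Lemma normc_sign (b : bool) : normc ((-1) ^+ b : C) = 1.
Proof. by rewrite normcX normcN normc1 expr1n. Qed.

Lemma normc_sum (I : Type) (r : seq I) (P : pred I) (F : I -> C) :
  normc (\sum_(i <- r | P i) F i) <= \sum_(i <- r | P i) normc (F i).
Proof.
elim/big_ind2: _ => //; first by rewrite normc0.
by move=> x1 x2 y1 y2 h1 h2; apply: le_trans (le_normcD _ _) _; exact: lerD.
Qed.

Lemma normc_re z : `|Re z| <= normc z.
Proof.
by rewrite -(ler_pXn2r (n := 2)) ?nnegrE ?normc_ge0// real_normK ?num_real//
  sqr_normcE lerDl sqr_ge0.
Qed.

Lemma normc_im z : `|Im z| <= normc z.
Proof.
by rewrite -(ler_pXn2r (n := 2)) ?nnegrE ?normc_ge0// real_normK ?num_real//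
  sqr_normcE lerDr sqr_ge0.
Qed.

Lemma normc_le_re_im z : normc z <= `|Re z| + `|Im z|.
Proof.
rewrite -(ler_pXn2r (n := 2)) ?nnegrE ?normc_ge0// ?addr_ge0//.
rewrite sqr_normcE -[Re z ^+ 2]real_normK ?num_real//.
rewrite -[Im z ^+ 2]real_normK ?num_real//.
have := normr_ge0 (Re z); have := normr_ge0 (Im z); nra.
Qed.

Lemma conjcM z w : ((z * w)^*)%C = (z^*)%C * (w^*)%C.
Proof. exact: rmorphM. Qed.

Lemma conjc_sum (I : Type) (r : seq I) (P : pred I) (F : I -> C) :
  ((\sum_(i <- r | P i) F i)^*)%C = \sum_(i <- r | P i) ((F i)^*)%C.
Proof. exact: rmorph_sum. Qed.

Lemma real_complexM (x y : R) : ((x * y)%:C)%C = (x%:C)%C * (y%:C)%C :> C.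
Proof. exact: rmorphM. Qed.

Lemma real_complexX (x : R) n : ((x ^+ n)%:C)%C = (x%:C)%C ^+ n :> C.
Proof. exact: rmorphXn. Qed.

Lemma real_complex_sum (I : Type) (r : seq I) (P : pred I) (F : I -> R) :
  ((\sum_(i <- r | P i) F i)%:C)%C = \sum_(i <- r | P i) ((F i)%:C)%C :> C.
Proof. exact: rmorph_sum. Qed.

Lemma conjc_sign (b : bool) : (((-1) ^+ b : C)^*)%C = (-1) ^+ b.
Proof. by case: b; rewrite ?expr0 ?expr1 ?rmorphN1 ?rmorph1. Qed.

Lemma norm_normc z : `|z| = ((normc z)%:C)%C.
Proof. by rewrite normc_def; case: z. Qed.

End ComplexModulus.

Section RootsOfUnity.
Variable R : realType.
Local Notation C := R[i].

(** [X^n - 1] splits over the algebraically closed field [R[i]] and is separable in characteristic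
    0, so it has [n] distinct roots, among them a primitive one. *)
Lemma prim_root_complex n : (0 < n)%N -> exists w : C, n.-primitive_root w.
Proof.
move=> n0; have [r] := closed_field_poly_normal ('X^n - 1 : {poly C}).
rewrite lead_coefXnsubC// scale1r => rE.
have szr : (size r).+1 = n.+1 by rewrite -(size_prod_XsubC r id) -rE size_XnsubC.
have /hasP[w _ pw] : has n.-primitive_root r; last by exists w.
apply: has_prim_root => //; last by case: szr => ->.
- by apply/allP => z; rewrite -root_prod_XsubC -rE.
- by rewrite -separable_prod_XsubC -rE separable_Xn_sub_1// pnatr_eq0 -lt0n.
Qed.

Lemma normc_prim_root n (w : C) : n.-primitive_root w -> normc w = 1.
Proof.
move=> pw; have n0 := prim_order_gt0 pw; have := prim_expr_order pw.
move=> /(congr1 (@normc R)); rewrite normc1 normcX => /eqP.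
by rewrite pexpr_eq1 ?normc_ge0// => /eqP.
Qed.

Lemma conj_unimodular (z : C) : normc z = 1 -> z * (z^*)%C = 1.
Proof. by move=> z1; rewrite -sqr_normcJ z1 expr1n. Qed.

(** Orthogonality of characters: the sum is geometric in [x = w^a * conj (w^b)], where [x^n = 1],
    and [x <> 1] unless [a = b]. *)
Lemma sum_prim_rootX n (w : C) (a b : nat) : n.-primitive_root w ->
  (a < n)%N -> (b < n)%N ->
  \sum_(j < n) (w ^+ (j * a)) * ((w ^+ (j * b))^*)%C = (n * (a == b))%:R.
Proof.
move=> pw an bn; have w1 := normc_prim_root pw.
pose x := w ^+ a * ((w ^+ b)^*)%C.
have -> : \sum_(j < n) w ^+ (j * a) * ((w ^+ (j * b))^*)%C = \sum_(j < n) x ^+ j.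
  apply: eq_bigr => j _; rewrite exprMn -!rmorphXn -!exprM.
  by rewrite (mulnC a) (mulnC b).
have [ab|ab] := eqVneq a b.
  rewrite muln1 (eq_bigr (fun=> 1)) ?sumr_const ?card_ord// => j _.
  by rewrite /x ab conj_unimodular ?expr1n// normcX w1 expr1n.
rewrite muln0; have x1 : x != 1.
  apply: contra ab => /eqP x1.
  have : w ^+ a = w ^+ b.
    have wb : w ^+ b * ((w ^+ b)^*)%C = 1 by rewrite conj_unimodular// normcX w1 expr1n.
    by rewrite -[LHS]mulr1 -wb mulrCA -/x x1 mulr1.
  by move/eqP; rewrite (eq_prim_root_expr pw) !modn_small.
have : x ^+ n - 1 = 0.
  rewrite /x exprMn -rmorphXn -!exprM ![(_ * n)%N]mulnC !exprM.
  by rewrite (prim_expr_order pw) !expr1n rmorph1 mulr1 subrr.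
by rewrite subrX1 => /eqP; rewrite mulf_eq0 subr_eq0 (negbTE x1) /= => /eqP.
Qed.

Lemma parseval n (w : C) (z : nat -> C) : n.-primitive_root w ->
  \sum_(j < n) normc (\sum_(a < n) z a * w ^+ (j * a)) ^+ 2 =
  n%:R * \sum_(a < n) normc (z a) ^+ 2.
Proof.
move=> pw; apply: (@complexI R); rewrite rmorphM !rmorph_sum rmorph_nat /=.
under eq_bigr do rewrite sqr_normcJ rmorph_sum /= big_distrlr /=.
rewrite exchange_big mulr_sumr /=; apply: eq_bigr => a _.
rewrite exchange_big (bigD1 a)//= [X in _ + X]big1 => [|b ba].
  under eq_bigr => j _ do rewrite rmorphM mulrACA.
  rewrite -mulr_sumr sum_prim_rootX ?ltn_ord// eqxx muln1 addr0.
  by rewrite mulrC sqr_normcJ.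
under eq_bigr => j _ do rewrite rmorphM mulrACA.
rewrite -mulr_sumr sum_prim_rootX ?ltn_ord//.
by rewrite eq_sym -val_eqE in ba; rewrite (negbTE ba) muln0 mulr0.
Qed.

End RootsOfUnity.

(** * Khinchine's inequality *)

Section RandomSigns.
Variable R : realType.
Local Notation C := R[i].

Lemma normc_parallelogram (x a : C) :
  normc (x + a) ^+ 2 + normc (x - a) ^+ 2 = 2 * (normc x ^+ 2 + normc a ^+ 2).
Proof. by rewrite !sqr_normcE; case: x => x1 x2; case: a => a1 a2 /=; ring. Qed.

(** The gap is [8 * Im (conj x * a) ^ 2]; this controls the mean fourth power over one random
    sign. *)
Lemma normc4_parallelogram (x a : C) :
  normc (x + a) ^+ 4 + normc (x - a) ^+ 4 <=
  2 * (normc x ^+ 4 + 6 * normc x ^+ 2 * normc a ^+ 2 + normc a ^+ 4).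
Proof.
rewrite !(exprM _ 2 2) !sqr_normcE; case: x => x1 x2; case: a => a1 a2 /=.
rewrite -subr_ge0.
have -> : 2 * ((x1 ^+ 2 + x2 ^+ 2) ^+ 2 +
   6 * (x1 ^+ 2 + x2 ^+ 2) * (a1 ^+ 2 + a2 ^+ 2) +
   (a1 ^+ 2 + a2 ^+ 2) ^+ 2) -
  (((x1 + a1) ^+ 2 + (x2 + a2) ^+ 2) ^+ 2 +
   ((x1 - a1) ^+ 2 + (x2 - a2) ^+ 2) ^+ 2) = 8 * (x1 * a2 - x2 * a1) ^+ 2.
  by ring.
by rewrite mulr_ge0 ?sqr_ge0.
Qed.

(* With [v] the sum of the squared moduli of the coefficients still to be
   signed, [x ^+ 4 + 6 * x ^+ 2 * v + 3 * v ^+ 2] bounds the mean over their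
   signs of the fourth power of the final modulus. *)
Definition khinchine_potential (s v x : R) : R :=
  3 * s ^+ 2 * (x ^+ 2 + v) - (x ^+ 4 + 6 * x ^+ 2 * v + 3 * v ^+ 2).

(** Over the two signs the quadratic terms balance by the parallelogram law, and the quartic ones
    leave a surplus of at least [4 * normc a ^ 4]. *)
Lemma khinchine_potential_step (s v : R) (x a : C) :
  2 * khinchine_potential s (v + normc a ^+ 2) (normc x) <=
  khinchine_potential s v (normc (x + a)) +
  khinchine_potential s v (normc (x - a)).
Proof.
rewrite /khinchine_potential.
have h2 := normc_parallelogram x a; have h4 := normc4_parallelogram x a.
have a4 : normc a ^+ 4 = (normc a ^+ 2) ^+ 2 by rewrite -exprM.
move: h2 h4; rewrite a4.
set P := normc (x + a) ^+ 2; set Q := normc (x - a) ^+ 2.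
set P4 := normc (x + a) ^+ 4; set Q4 := normc (x - a) ^+ 4.
set X := normc x ^+ 2; set A := normc a ^+ 2.
have := sqr_ge0 A; set X4 := normc x ^+ 4 => A2 h2 h4.
have -> : P = 2 * (X + A) - Q by rewrite -h2 addrK.
lra.
Qed.

(** Method of conditional expectations: the signs are fixed one at a time, each so that the
    potential summed over [j] does not decrease. *)
Lemma khinchine_signs (s : R) (a : nat -> nat -> C) (lam : nat -> R) (L : nat)
    (ks : seq nat) (X : nat -> C) : uniq ks ->
  (forall k j, normc (a k j) = lam k) ->
  exists e : nat -> bool,
    \sum_(j < L) khinchine_potential s (\sum_(k <- ks) lam k ^+ 2) (normc (X j))
    <= \sum_(j < L) khinchine_potential s 0
         (normc (X j + \sum_(k <- ks) (-1) ^+ e k * a k j)).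
Proof.
move=> + alam; elim: ks X => [|k ks IH] X /=.
  by exists (fun=> false); rewrite big_nil ler_sum// => j _; rewrite big_nil addr0.
move=> /andP[kks uks]; set v := \sum_(k <- ks) lam k ^+ 2.
pose pot b := \sum_(j < L) khinchine_potential s v (normc (X j + (-1) ^+ b * a k j)).
have [b hb] : exists b : bool, \sum_(j < L)
    khinchine_potential s (\sum_(i <- k :: ks) lam i ^+ 2) (normc (X j)) <= pot b.
  set W := \sum_(j < L) _.
  have : 2 * W <= pot false + pot true.
    rewrite /pot -big_split mulr_sumr /=; apply: ler_sum => j _.
    rewrite expr0 expr1 mul1r mulN1r big_cons -/v [lam k ^+ 2 + v]addrC -(alam k j).
    exact: khinchine_potential_step.
  have [hf|hf] := leP W (pot false); first by exists false.
  by move=> h; exists true; lra.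
have [e he] := IH (fun j => X j + (-1) ^+ b * a k j) uks.
exists (fun i => if i == k then b else e i).
apply: le_trans hb (le_trans he _); apply: ler_sum => j _.
rewrite big_cons eqxx addrA le_eqVlt; apply/orP; left; apply/eqP.
congr (khinchine_potential _ _ (normc (_ + _))).
apply: eq_big_seq => i iks; case: eqVneq => // ik.
by rewrite ik (negbTE kks) in iks.
Qed.

(* Cubic tangent line [2 s^3 x >= 3 s^2 x^2 - x^4] at [s], with [s] twice the
   standard deviation. *)
Lemma khinchine_L1 (a : nat -> nat -> C) (lam : nat -> R) (L : nat)
    (ks : seq nat) : uniq ks -> (forall k j, normc (a k j) = lam k) ->
  exists e : nat -> bool,
    L%:R / 2 * Num.sqrt (\sum_(k <- ks) lam k ^+ 2) <=
    \sum_(j < L) normc (\sum_(k <- ks) (-1) ^+ e k * a k j).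
Proof.
move=> uks alam; set V := \sum_(k <- ks) lam k ^+ 2; set t := Num.sqrt V.
have t0 : 0 <= t := sqrtr_ge0 _.
have tV : t ^+ 2 = V by rewrite sqr_sqrtr// sumr_ge0// => k _; exact: sqr_ge0.
have [e he] := khinchine_signs (2 * t) L (fun=> 0) uks alam; exists e.
case: (ltrgt0P t) (t0) => [tpos|//|->] _; last first.
  by rewrite mulr0 sumr_ge0// => j _; exact: normc_ge0.
move: he; rewrite -/V -tV.
(* With [x = 0], [v = t ^ 2] and [s = 2 * t], the initial potential is [12 t^4 - 3 t^4]. *)
rewrite (eq_bigr (fun=> 9 * t ^+ 4)); last first.
  by move=> j _; rewrite normc0 /khinchine_potential; ring.
rewrite sumr_const card_ord -[_ *+ L]mulr_natl => he.
rewrite -(ler_pM2l (x := 16 * t ^+ 3)) ?mulr_gt0 ?exprn_gt0//.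
apply: (@le_trans _ _ (L%:R * (9 * t ^+ 4))).
  have -> : 16 * t ^+ 3 * (L%:R / 2 * t) = L%:R * (8 * t ^+ 4) by field.
  by rewrite ler_wpM2l// ler_wpM2r ?exprn_ge0 ?ler_nat.
apply: le_trans he _; rewrite mulr_sumr; apply: ler_sum => j _.
rewrite add0r /khinchine_potential; set u := normc _.
have u0 : 0 <= u := normc_ge0 _.
rewrite -subr_ge0.
have -> : 16 * t ^+ 3 * u - (3 * (2 * t) ^+ 2 * (u ^+ 2 + 0) -
  (u ^+ 4 + 6 * u ^+ 2 * 0 + 3 * 0 ^+ 2)) =
  u * (u - 2 * t) ^+ 2 * (u + 4 * t) by ring.
apply: mulr_ge0; last by rewrite addr_ge0// mulr_ge0.
by rewrite mulr_ge0// sqr_ge0.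
Qed.

(** Duality of discrete L1 and L-infinity: for the phase [g] of [h], the sum of the [|h j|] is the
    sum of [g j * conj (h j)], and exchanging sums exposes the Fourier coefficients of [g]. *)
Lemma dual_phases (w : C) (lam : nat -> R) (L : nat) (ks : seq nat) :
  uniq ks -> normc w = 1 -> (forall k, 0 <= lam k) ->
  exists2 g : nat -> C, forall j, normc (g j) <= 1 &
    L%:R / 2 * Num.sqrt (\sum_(k <- ks) lam k ^+ 2) <=
    \sum_(k <- ks) lam k * normc (\sum_(j < L) g j * ((w ^+ (j * k))^*)%C).
Proof.
move=> uks w1 lam0; pose a k j : C := ((lam k)%:C)%C * w ^+ (j * k).
have alam k j : normc (a k j) = lam k.
  by rewrite normcM normc_real ger0_norm// normcX w1 expr1n mulr1.
have [e he] := khinchine_L1 L uks alam.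
pose h j := \sum_(k <- ks) (-1) ^+ e k * a k j.
(* Where [h j = 0] the quotient is 0 by the convention on division, so the bound by 1 persists. *)
exists (fun j => h j / ((normc (h j))%:C)%C).
  move=> j; rewrite normcM normcV normc_real ger0_norm ?normc_ge0//.
  by have [->|h0] := eqVneq (normc (h j)) 0; rewrite ?mul0r ?ler01 ?divff.
apply: le_trans he _.
have hE j : ((normc (h j))%:C)%C =
    h j / ((normc (h j))%:C)%C * ((h j)^*)%C.
  rewrite mulrAC -sqr_normcJ; have [->|h0] := eqVneq (normc (h j)) 0.
    by rewrite expr0n /= mul0r.
  by rewrite rmorphXn /= expr2 mulfK// eq_complex /= negb_and h0.
rewrite -[leLHS]ger0_norm ?sumr_ge0// => [|j _]; last exact: normc_ge0.
rewrite -normc_real rmorph_sum /=.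
under eq_bigr do rewrite -/(h _) hE {2}/h rmorph_sum mulr_sumr /=.
rewrite exchange_big /=; apply: le_trans (normc_sum _ _ _) _.
apply: ler_sum => k _.
rewrite (eq_bigr (fun j : 'I_L => ((-1) ^+ e k * ((lam k)%:C)%C) *
   (h j / ((normc (h j))%:C)%C * ((w ^+ (j * k))^*)%C))); last first.
  by move=> j _; rewrite !conjcM conjc_sign conjc_real; ring.
by rewrite -mulr_sumr !normcM normc_sign mul1r normc_real ger0_norm.
Qed.

End RandomSigns.

(** * Fejér kernels on Toeplitz sections *)

Section FejerToeplitz.
Variable R : realType.
Local Notation C := R[i].

Lemma sum_unique_index (V : pzRingType) (I : finType) (P : pred I) (F : I -> V) :
  (forall i j, P i -> P j -> i = j) ->
  \sum_i (P i)%:R * F i = if [pick i | P i] is Some i then F i else 0.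
Proof.
move=> uP; case: pickP => [i Pi|P0]; last first.
  by rewrite big1// => i _; rewrite P0 mul0r.
rewrite (bigD1 i)//= Pi mul1r big1 ?addr0// => j ji.
have [Pj|] := boolP (P j); last by rewrite mul0r.
by rewrite (uP _ _ Pj Pi) eqxx in ji.
Qed.

Lemma shift_unique (M d e : nat) (i j : 'I_M) :
  (i + d == e)%N -> (j + d == e)%N -> i = j.
Proof. by move=> /eqP <- /eqP/addIn ij; apply: val_inj. Qed.

(** Up to a unimodular factor, the sum for a window [p] is a discrete Fourier transform in [a].
    Parseval gives one factor [L]; the other arises because each [m] lies in at most [L] windows,
    one for each [a]. *)
Lemma window_energy (L : nat) (w : C) (M P d : nat) (x u : nat -> C) :
  L.-primitive_root w -> (forall a, (a < L)%N -> normc (u a) <= 1) ->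
  \sum_(p < P) \sum_(j < L) normc (\sum_(m < M) \sum_(a < L)
     (m + d == p + a)%N%:R * (u a * x m * w ^+ (j * m))) ^+ 2
  <= L%:R ^+ 2 * \sum_(m < M) normc (x m) ^+ 2.
Proof.
move=> pw u1; have w1 := normc_prim_root pw.
pose z p a := \sum_(m < M) (m + d == p + a)%N%:R * (u a * x m).
have zE (p j : nat) : normc (\sum_(m < M) \sum_(a < L)
     (m + d == p + a)%N%:R * (u a * x m * w ^+ (j * m))) =
   normc (\sum_(a < L) z p a * w ^+ (j * a)).
  have nw k t : normc t = normc (w ^+ k * t).
    by rewrite normcM normcX w1 expr1n mul1r.
  rewrite [LHS](nw (j * d)%N) [RHS](nw (j * p)%N).
  congr (normc _); rewrite exchange_big !mulr_sumr /=; apply: eq_bigr => a _.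
  rewrite mulr_suml !mulr_sumr; apply: eq_bigr => m _.
  have [mp|_] := eqVneq (m + d)%N (p + a)%N; last by rewrite !(mul0r, mulr0).
  rewrite !mul1r mulrCA -exprD -mulnDr (addnC d) mp mulnDr exprD.
  by ring.
under eq_bigr do under eq_bigr do rewrite zE.
under eq_bigr do rewrite (parseval (z _) pw).
have z1 p a : (a < L)%N -> normc (z p a) ^+ 2 <=
    \sum_(m < M) (m + d == p + a)%N%:R * normc (x m) ^+ 2.
  move=> aL; rewrite /z !sum_unique_index; try exact: shift_unique.
  case: pickP => [m _|_]; last by rewrite normc0 expr0n.
  rewrite normcM exprMn ler_piMl ?sqr_ge0// exprn_ile1 ?normc_ge0//.
  exact: u1.
apply: (@le_trans _ _ (\sum_(p < P) L%:R * \sum_(a < L) \sum_(m < M)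
    (m + d == p + a)%N%:R * normc (x m) ^+ 2)).
  apply: ler_sum => p _; rewrite ler_wpM2l ?ler0n//.
  by apply: ler_sum => a _; exact: z1.
rewrite -mulr_sumr exchange_big expr2 -mulrA ler_wpM2l ?ler0n//=.
rewrite mulr_natl -[in leRHS](card_ord L) -sumr_const; apply: ler_sum => a _.
rewrite exchange_big /=; apply: ler_sum => m _.
under eq_bigr do rewrite eq_sym.
rewrite sum_unique_index; last exact: shift_unique.
by case: pickP => // _; exact: sqr_ge0.
Qed.

(* The Toeplitz matrix of [c]-shifted frequencies is a superposition, over the
   [L]-th roots of unity and over the windows of length [L], of rank-one forms
   [X p j * Y p j]; Parseval bounds both factors. *)
Lemma fejer_bilinear (L : nat) (w : C) (M c : nat) (x y u v g : nat -> C) :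
  L.-primitive_root w -> (forall a, (a < L)%N -> normc (u a) <= 1) ->
  (forall b, (b < L)%N -> normc (v b) <= 1) -> (forall j, normc (g j) <= 1) ->
  2 * normc (\sum_(l < M) \sum_(m < M) y l * x m *
     \sum_(a < L) \sum_(b < L) (m + b == l + c + a)%N%:R * (u a * v b) *
        \sum_(j < L) g j * (w ^+ (j * l) * ((w ^+ (j * m))^*)%C))
  <= L%:R ^+ 2 * (\sum_(m < M) normc (x m) ^+ 2 + \sum_(l < M) normc (y l) ^+ 2).
Proof.
move=> pw u1 v1 g1; set P := (M + L).+1.
pose X (p j : nat) := \sum_(m < M) \sum_(a < L)
   (m + L == p + a)%N%:R * (u a * x m * ((w ^+ (j * m))^*)%C).
pose Y (p j : nat) := \sum_(l < M) \sum_(b < L)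
   (l + (c + L) == p + b)%N%:R * (v b * y l * w ^+ (j * l)).
(* The first indicator forces [p = m + L - a], a natural number below [P] since [a < L]; the second
   then becomes [m + b = l + c + a]. *)
have meet (m l : 'I_M) (a b : 'I_L) : \sum_(p < P)
    (m + L == p + a)%N%:R * (l + (c + L) == p + b)%N%:R =
    (m + b == l + c + a)%N%:R :> C.
  under eq_bigr do rewrite eq_sym.
  rewrite sum_unique_index; last exact: shift_unique.
  case: pickP => [p /eqP pE|np] /=.
    congr (nat_of_bool _)%:R; apply/eqP/eqP; lia.
  have pP : (m + L - a < P)%N by rewrite /P; have := ltn_ord m; lia.
  have := np (Ordinal pP); have := ltn_ord a => /= aL.
  by rewrite subnK ?eqxx//; lia.
have -> : \sum_(l < M) \sum_(m < M) y l * x m *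
     (\sum_(a < L) \sum_(b < L) (m + b == l + c + a)%N%:R * (u a * v b) *
        \sum_(j < L) g j * (w ^+ (j * l) * ((w ^+ (j * m))^*)%C)) =
   \sum_(p < P) \sum_(j < L) g j * (X p j * Y p j).
  rewrite exchange_big [RHS]exchange_big /=.
  under [RHS]eq_bigr => j _ do under eq_bigr => p _ do
    rewrite /X mulr_suml mulr_sumr.
  under [RHS]eq_bigr => j _ do rewrite exchange_big /=.
  rewrite [RHS]exchange_big /=; apply: eq_bigr => m _.
  under [RHS]eq_bigr => j _ do under eq_bigr => p _ do
    rewrite /Y mulr_sumr mulr_sumr.
  under [RHS]eq_bigr => j _ do rewrite exchange_big /=.
  rewrite [RHS]exchange_big /=; apply: eq_bigr => l _.
  under [RHS]eq_bigr => j _ do under eq_bigr => p _ do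
    rewrite big_distrlr mulr_sumr /=.
  under [RHS]eq_bigr => j _ do rewrite exchange_big /=.
  rewrite [RHS]exchange_big mulr_sumr /=; apply: eq_bigr => a _.
  under [RHS]eq_bigr => j _ do under eq_bigr => p _ do rewrite mulr_sumr.
  under [RHS]eq_bigr => j _ do rewrite exchange_big /=.
  rewrite [RHS]exchange_big mulr_sumr /=; apply: eq_bigr => b _.
  rewrite -meet !mulr_sumr; apply: eq_bigr => j _.
  rewrite !mulr_suml mulr_sumr; apply: eq_bigr => p _.
  ring.
have XE : \sum_(p < P) \sum_(j < L) normc (X p j) ^+ 2 <=
    L%:R ^+ 2 * \sum_(m < M) normc (x m) ^+ 2.
  have H := @window_energy L w M P L (fun m => ((x m)^*)%C)
    (fun a => ((u a)^*)%C) pw.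
  have -> : \sum_(m < M) normc (x m) ^+ 2 = \sum_(m < M) normc ((x m)^*)%C ^+ 2.
    by apply: eq_bigr => m _; rewrite normc_conj.
  apply: le_trans (H _); last by move=> a aL; rewrite normc_conj u1.
  rewrite le_eqVlt; apply/orP; left; apply/eqP.
  apply: eq_bigr => p _; apply: eq_bigr => j _; congr (_ ^+ _).
  rewrite -normc_conj /X conjc_sum; congr normc; apply: eq_bigr => m _.
  rewrite conjc_sum; apply: eq_bigr => a _.
  by rewrite !conjcM conjc_nat conjcK.
have YE := @window_energy L w M P (c + L) y v pw v1.
rewrite mulrDr; apply: le_trans (lerD XE YE).
rewrite -big_split /=; apply: le_trans (_ : 2 * \sum_(p < P) \sum_(j < L)
   (normc (X p j) * normc (Y p j)) <= _).
  rewrite ler_pM2l//; apply: le_trans (normc_sum _ _ _) _; apply: ler_sum => p _.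
  apply: le_trans (normc_sum _ _ _) _; apply: ler_sum => j _.
  by rewrite !normcM ler_piMl ?mulr_ge0 ?normc_ge0.
rewrite mulr_sumr; apply: ler_sum => p _; rewrite -big_split mulr_sumr /=.
apply: ler_sum => j _; rewrite -subr_ge0.
have := sqr_ge0 (normc (X p j) - normc (Y p j)); rewrite -/(Y p j); lra.
Qed.

End FejerToeplitz.

(** * Bloch coefficient sequences *)

Section BlochCoefficients.
Variable R : realType.
Local Notation C := R[i].

(** For [K >= 0], rescaling [x] against [y] shows that this bounds the norm of the [M]-by-[M]
    section by [K]; the sum of squares avoids square roots. *)
Definition bilinear_bound (M : nat) (D : nat -> nat -> C) (K : R) :=
  forall x y : nat -> C,
    2 * normc (\sum_(l < M) \sum_(m < M) y l * x m * D l m) <=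
    K * (\sum_(m < M) normc (x m) ^+ 2 + \sum_(l < M) normc (y l) ^+ 2).

Definition toeplitz_deriv (b : nat -> C) (r : R) (l m : nat) : C :=
  if (l < m)%N then (m - l)%:R * b (m - l)%N * (r%:C)%C ^+ (m - l).-1 else 0.

(* Finite-section form of the Bloch condition; it implies both the matricial and
   the scalar one, so that a single construction serves both assertions. *)
Definition bloch_coef (K : R) (b : nat -> C) :=
  normc (b 0%N) <= K /\
  forall r M, 0 <= r < 1 -> bilinear_bound M (toeplitz_deriv b r) (K / (1 - r)).

Lemma bilinear_bound_eq M (D D' : nat -> nat -> C) (K : R) :
  (forall l m, (l < M)%N -> (m < M)%N -> D l m = D' l m) ->
  bilinear_bound M D K -> bilinear_bound M D' K.
Proof.
move=> DD' h x y; rewrite (eq_bigr (fun l : 'I_M => \sum_(m < M) y l * x m * D l m)).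
  exact: h.
by move=> l _; apply: eq_bigr => m _; rewrite DD'.
Qed.

Lemma bilinear_bound_le M (D : nat -> nat -> C) (K K' : R) : K <= K' ->
  bilinear_bound M D K -> bilinear_bound M D K'.
Proof.
move=> KK' h x y; apply: le_trans (h x y) _; rewrite ler_wpM2r//.
by rewrite addr_ge0 ?sumr_ge0// => i _; exact: sqr_ge0.
Qed.

Lemma bilinear_bound_sum M (I : Type) (s : seq I) (P : pred I)
    (D : I -> nat -> nat -> C) (K : I -> R) :
  (forall i, P i -> bilinear_bound M (D i) (K i)) ->
  bilinear_bound M (fun l m => \sum_(i <- s | P i) D i l m) (\sum_(i <- s | P i) K i).
Proof.
move=> h x y.
have -> : \sum_(l < M) \sum_(m < M) y l * x m * (\sum_(i <- s | P i) D i l m) =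
    \sum_(i <- s | P i) \sum_(l < M) \sum_(m < M) y l * x m * D i l m.
  rewrite [RHS]exchange_big; apply: eq_bigr => l _.
  by rewrite [RHS]exchange_big; apply: eq_bigr => m _; rewrite mulr_sumr.
apply: (@le_trans _ _ (\sum_(i <- s | P i)
   2 * normc (\sum_(l < M) \sum_(m < M) y l * x m * D i l m))).
  by rewrite -mulr_sumr ler_pM2l// normc_sum.
by rewrite mulr_suml; apply: ler_sum => i Pi; exact: h.
Qed.

Lemma bilinear_boundZ M (D : nat -> nat -> C) (K : R) (z : C) :
  bilinear_bound M D K -> bilinear_bound M (fun l m => z * D l m) (normc z * K).
Proof.
move=> h x y.
have -> : \sum_(l < M) \sum_(m < M) y l * x m * (z * D l m) =
    z * \sum_(l < M) \sum_(m < M) y l * x m * D l m.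
  rewrite mulr_sumr; apply: eq_bigr => l _; rewrite mulr_sumr.
  by apply: eq_bigr => m _; ring.
by rewrite normcM mulrCA -mulrA ler_wpM2l ?normc_ge0//; exact: h.
Qed.

Lemma bilinear_boundD M (D D' : nat -> nat -> C) (K K' : R) :
  bilinear_bound M D K -> bilinear_bound M D' K' ->
  bilinear_bound M (fun l m => D l m + D' l m) (K + K').
Proof.
move=> h h' x y; rewrite [leRHS]mulrDl; apply: le_trans (lerD (h x y) (h' x y)).
rewrite -mulrDr ler_pM2l//; apply: le_trans (le_normcD _ _).
rewrite le_eqVlt; apply/orP; left; apply/eqP; congr normc.
rewrite -big_split; apply: eq_bigr => l _; rewrite -big_split.
by apply: eq_bigr => m _; rewrite mulrDr.
Qed.

(** The count is the Fejér triangle [2q - |k - 3q|], at least [q] here: each [b] in the upper half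
    of its range, or in the lower half once [k > 3q], has a matching [a]. *)
Lemma fejer_pairs (q k : nat) : (q + q <= k < 4 * q)%N ->
  (q <= \sum_(a < q + q) \sum_(b < q + q) (k + b == 3 * q + a))%N.
Proof.
move=> /andP[qk kq]; rewrite exchange_big /=.
have ex b : (b < q + q)%N -> (3 * q <= k + b < 5 * q)%N ->
    (1 <= \sum_(a < q + q) (k + b == 3 * q + a))%N.
  move=> bq kb; have aq : (k + b - 3 * q < q + q)%N by lia.
  rewrite (bigD1 (Ordinal aq))//=.
  by rewrite subnKC ?eqxx//; case/andP: kb.
rewrite big_split_ord /=; have [k3|k3] := leqP k (3 * q)%N.
  apply: leq_trans (leq_addl _ _); rewrite -[X in (X <= _)%N](card_ord q) -sum1_card.
  by apply: leq_sum => b _; have := ltn_ord b => bq; apply: ex; lia.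
apply: leq_trans (leq_addr _ _); rewrite -[X in (X <= _)%N](card_ord q) -sum1_card.
by apply: leq_sum => b _; have := ltn_ord b => bq; apply: ex; lia.
Qed.

(* The coefficients [k * r ^ (k - 1)] of the derivative, [k = 3 * q + a - b] with
   [a, b < 2 * q], separate as
   [((3 * q - b) + a) * r ^ q * r ^ a * r ^ (2 * q - 1 - b)]. *)
Lemma bloch_block (q : nat) (lam : nat -> R) : (0 < q)%N ->
  (forall k, 0 <= lam k) -> exists f : nat -> C,
  [/\ forall k, (k <= q)%N || (5 * q <= k)%N -> f k = 0,
      forall r M, 0 <= r < 1 ->
        bilinear_bound M (toeplitz_deriv f r) (5 * (q%:R * r ^+ q))
    & 4^-1 * Num.sqrt (\sum_(q + q <= k < 4 * q) lam k ^+ 2) <=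
      \sum_(q + q <= k < 4 * q) lam k * normc (f k)].
Proof.
move=> q0 lam0; pose L := (q + q)%N; pose c := (3 * q)%N.
have L0 : (0 < L)%N by rewrite /L; lia.
have [w pw] := prim_root_complex R L0; have w1 := normc_prim_root pw.
have [g g1 hg] := dual_phases L (iota_uniq (q + q) (4 * q - (q + q))) w1 lam0.
pose G k := \sum_(j < L) g j * ((w ^+ (j * k))^*)%C.
pose N k := \sum_(a < L) \sum_(b < L) (k + b == c + a)%N%:R : C.
(* [N] is the Fejér weight centered at [c = 3q], and [G] the Fourier coefficient of the phase;
   dividing by [L ^ 2] offsets the bound of [fejer_bilinear]. *)
exists (fun k => (L%:R ^+ 2)^-1 * (N k * G k)); split.
- move=> k kq; rewrite /N big1 ?mul0r ?mulr0// => a _; rewrite big1// => b _.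
  have := ltn_ord a; have := ltn_ord b; rewrite /L => bL aL.
  by case: eqP => //; rewrite /c; lia.
- move=> r M /andP[r0 r1].
  pose E (u v : nat -> C) (l m : nat) := \sum_(a < L) \sum_(b < L)
    (m + b == l + c + a)%N%:R * (u a * v b) *
      \sum_(j < L) g j * (w ^+ (j * l) * ((w ^+ (j * m))^*)%C).
  pose rC := (r%:C)%C.
  (* The factor [k = (c - b) + a] of the derivative is distributed over [T1] and [T2], each part
     normalized to be at most 1; the prefactors [c] and [L] add up to [5q]. *)
  pose T1 := E (fun a => rC ^+ a) (fun b => rC ^+ (L.-1 - b) * ((c - b)%N%:R / c%:R)).
  pose T2 := E (fun a => rC ^+ a * (a%:R / L%:R)) (fun b => rC ^+ (L.-1 - b)).
  have rX n : normc (rC ^+ n) <= 1.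
    by rewrite normcX normc_real ger0_norm// exprn_ile1// ltW.
  have frac (a b : nat) : (a <= b)%N -> normc (a%:R / b%:R : C) <= 1.
    move=> ab; rewrite normcM normcV !normc_nat.
    have [->|b0] := posnP b; first by rewrite invr0 mulr0.
    by rewrite ler_pdivrMr ?ltr0n// mul1r ler_nat.
  have bE u v : (forall a, (a < L)%N -> normc (u a) <= 1) ->
      (forall b, (b < L)%N -> normc (v b) <= 1) ->
      bilinear_bound M (E u v) (L%:R ^+ 2).
    by move=> u1 v1 x y; exact: fejer_bilinear.
  have b1 : bilinear_bound M T1 (L%:R ^+ 2).
    apply: bE => [a _|b _]; first exact: rX.
    by rewrite normcM mulr_ile1 ?normc_ge0// frac// leq_subr.
  have b2 : bilinear_bound M T2 (L%:R ^+ 2).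
    apply: bE => [a aL|b _]; last exact: rX.
    by rewrite normcM mulr_ile1 ?normc_ge0// frac// ltnW.
  have L2 : (L%:R : C) != 0 by rewrite pnatr_eq0 -lt0n.
  have c2 : (c%:R : C) != 0 by rewrite pnatr_eq0 -lt0n /c; lia.
  have := bilinear_boundD (bilinear_boundZ (c%:R * rC ^+ q / L%:R ^+ 2) b1)
    (bilinear_boundZ (L%:R * rC ^+ q / L%:R ^+ 2) b2).
  have -> : normc (c%:R * rC ^+ q / L%:R ^+ 2) * L%:R ^+ 2 +
     normc (L%:R * rC ^+ q / L%:R ^+ 2) * L%:R ^+ 2 = 5 * (q%:R * r ^+ q).
    rewrite !normcM normcV !normcX !normc_nat normc_real ger0_norm//.
    rewrite !mulfVK ?expf_neq0 ?pnatr_eq0 -?lt0n// -mulrDl mulrA -natrD -natrM.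
    by congr (_%:R * _); rewrite /c /L; lia.
  apply: bilinear_bound_eq => l m _ _; rewrite /toeplitz_deriv.
  case: ltnP => [lm|ml]; last first.
    (* On and below the diagonal no pair contributes, since [b < c]. *)
    suff E0 u v : E u v l m = 0 by rewrite /T1 /T2 !E0 !mulr0 addr0.
    rewrite /E big1// => a _; rewrite big1// => b _.
    have bL : (b < q + q)%N := ltn_ord b.
    have -> : (m + b == l + c + a)%N = false by apply/eqP; rewrite /c; lia.
    by rewrite !mul0r.
  set k := (m - l)%N.
  have GE : \sum_(j < L) g j * (w ^+ (j * l) * ((w ^+ (j * m))^*)%C) = G k.
    apply: eq_bigr => j _; congr (_ * _).
    rewrite -(subnKC (ltnW lm)) -/k mulnDr exprD conjcM mulrA conj_unimodular ?mul1r//.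
    by rewrite normcX w1 expr1n.
  have kpred (a b k' : nat) : (a < q + q)%N -> (b < q + q)%N ->
      (k' + b = c + a)%N -> k'.-1 = (q + a + (L.-1 - b))%N by rewrite /L /c; lia.
  have ksplit (a b k' : nat) : (a < q + q)%N -> (b < q + q)%N ->
      (k' + b = c + a)%N -> k' = (c - b + a)%N by rewrite /c; lia.
  move: (G k) GE => Gk GE; transitivity (\sum_(a < L) \sum_(b < L)
      (k + b == c + a)%N%:R * (k%:R * rC ^+ k.-1 / L%:R ^+ 2 * Gk)); last first.
    under eq_bigr do rewrite -mulr_suml.
    by rewrite -mulr_suml -/(N k) -/rC; ring.
  rewrite /T1 /T2 /E GE !mulr_sumr -big_split; apply: eq_bigr => a _ /=.
  rewrite !mulr_sumr -big_split; apply: eq_bigr => b _ /=.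
  have bL : (b < q + q)%N := ltn_ord b; have aL : (a < q + q)%N := ltn_ord a.
  have -> : (m + b == l + c + a)%N = (k + b == c + a)%N by apply/eqP/eqP; lia.
  have [kE|_] := eqVneq (k + b)%N (c + a)%N; last by rewrite !(mul0r, mulr0, addr0).
  have -> : k%:R = (c - b)%N%:R + a%:R :> C by rewrite -natrD (ksplit _ _ _ aL bL kE).
  have -> : k.-1 = (q + a + (L.-1 - b))%N by exact: kpred.
  rewrite !exprD -/rC; field; rewrite ?L2 ?c2//.
- have -> : \sum_(q + q <= k < 4 * q) lam k * normc ((L%:R ^+ 2)^-1 * (N k * G k)) =
      (L%:R ^+ 2)^-1 * \sum_(q + q <= k < 4 * q) lam k * (normc (N k) * normc (G k)).
    rewrite mulr_sumr; apply: eq_bigr => k _.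
    by rewrite !normcM normcV normcX normc_nat mulrCA.
  rewrite ler_pdivlMl ?exprn_gt0 ?ltr0n//.
  (* The Fejér weight, at least [q], and [dual_phases] supply [q * (L / 2)]; divided by [L ^ 2] with
     [L = 2q] this is 1/4. *)
  apply: (@le_trans _ _ (q%:R * (L%:R / 2 *
      Num.sqrt (\sum_(q + q <= k < 4 * q) lam k ^+ 2)))).
    rewrite le_eqVlt; apply/orP; left; apply/eqP.
    by rewrite /L natrD; field.
  apply: le_trans (ler_wpM2l _ hg) _; first exact: ler0n.
  rewrite mulr_sumr big_seq [leRHS]big_seq; apply: ler_sum => k.
  rewrite mem_index_iota => kq; rewrite mulrCA ler_wpM2l// ler_wpM2r ?normc_ge0//.
  have -> : N k = (\sum_(a < L) \sum_(b < L) (k + b == c + a))%N%:R.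
    rewrite natr_sum; apply: eq_bigr => a _; rewrite natr_sum.
    by apply: eq_bigr.
  by rewrite normc_nat ler_nat; exact: fejer_pairs.
Qed.

End BlochCoefficients.

(** * Test sequences: monomials and lacunary sums of blocks *)

Section BlochExamples.
Variable R : realType.
Local Notation C := R[i].

Lemma sum_geom_le (r : R) n : 0 <= r < 1 -> \sum_(i < n) r ^+ i <= (1 - r)^-1.
Proof.
move=> /andP[r0 r1]; have r1' : 0 < 1 - r by rewrite subr_gt0.
rewrite -[leRHS]mul1r ler_pdivlMr// mulrC -opprB mulNr -subrX1 opprB.
by rewrite gerBl exprn_ge0.
Qed.

Lemma natr_geom_le (r : R) k : 0 <= r < 1 -> k%:R * r ^+ k.-1 <= (1 - r)^-1.
Proof.
move=> r01; apply: le_trans (sum_geom_le k r01); case/andP: r01 => r0 r1.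
rewrite mulr_natl -[X in _ *+ X](card_ord k) -sumr_const; apply: ler_sum => i _.
by apply: ler_wiXn2l => //; [exact: ltW|have := ltn_ord i; lia].
Qed.

(** Each of the [2^N] exponents in [(2^N, 2^(N+1)]] contributes at least [r^(2^(N+1))], so a
    lacunary term is at most twice a stretch of the geometric series, and these stretches are
    disjoint. *)
Lemma sum_lacunary_le (r : R) n : 0 <= r < 1 ->
  \sum_(i < n) (2 ^ i)%N%:R * r ^+ (2 ^ i) <= 2 / (1 - r).
Proof.
move=> r01; have /andP[r0 r1] := r01.
suff h N : \sum_(i < N.+1) (2 ^ i)%N%:R * r ^+ (2 ^ i) <=
    2 * \sum_(i < (2 ^ N).+1) r ^+ i.
  case: n => [|n].
    by rewrite big_ord0 divr_ge0// subr_ge0 ltW.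
  by apply: le_trans (h n) _; rewrite ler_pM2l// sum_geom_le.
elim: N => [|N IH].
  rewrite big_ord1 /= expn0 !big_ord_recr big_ord0 /= expr0 expr1; lra.
rewrite big_ord_recr /=; apply: le_trans (lerD IH (lexx _)) _.
rewrite -!(big_mkord xpredT (fun i => r ^+ i)).
rewrite [in leRHS](big_cat_nat (n := (2 ^ N).+1))//=; last first.
  by rewrite ltnS leq_exp2l.
rewrite mulrDr lerD2l expnS natrM -mulrA ler_pM2l// mulr_natl.
have e : (2 ^ N = (2 * 2 ^ N).+1 - (2 ^ N).+1)%N by lia.
rewrite [X in _ *+ X]e.
rewrite -[leLHS]sumr_const_nat [leLHS]big_nat [leRHS]big_nat; apply: ler_sum => i ib.
by apply: ler_wiXn2l => //; [exact: ltW|lia].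
Qed.

(** The matrix derivative is [k r^(k-1)] times a shift, which is a contraction. Monomials serve to
    show that each [diagS1 A k] is finite. *)
Lemma bloch_coef_monomial k : bloch_coef 1 (fun i => (i == k)%:R : C).
Proof.
split=> [|r M r01 x y].
  by rewrite normc_nat; case: eqP; rewrite ?ler01.
set S := \sum_(m < M) normc (x m) ^+ 2; set T := \sum_(l < M) normc (y l) ^+ 2.
have r0 : 0 <= r by case/andP: r01.
have c0 : 0 <= k%:R * r ^+ k.-1 by rewrite mulr_ge0 ?exprn_ge0.
apply: (@le_trans _ _ (k%:R * r ^+ k.-1 * (S + T))); last first.
  rewrite ler_wpM2r ?mul1r ?natr_geom_le// addr_ge0 ?sumr_ge0// => i _;
  exact: sqr_ge0.
have hS : \sum_(l < M) \sum_(m < M) (m + 0 == l + k)%N%:R * normc (x m) ^+ 2 <= S.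
  rewrite exchange_big; apply: ler_sum => m _.
  under eq_bigr do rewrite eq_sym.
  rewrite sum_unique_index; last exact: shift_unique.
  by case: pickP => // _; exact: sqr_ge0.
have hT : \sum_(l < M) \sum_(m < M) (m + 0 == l + k)%N%:R * normc (y l) ^+ 2 <= T.
  apply: ler_sum => l _.
  rewrite sum_unique_index; last exact: shift_unique.
  by case: pickP => // _; exact: sqr_ge0.
apply: le_trans (ler_wpM2l c0 (lerD hS hT)).
rewrite -big_split mulr_sumr /=.
apply: le_trans (ler_wpM2l _ (normc_sum _ _ _)) _ => //.
rewrite mulr_sumr; apply: ler_sum => l _.
rewrite -big_split mulr_sumr /=.
apply: le_trans (ler_wpM2l _ (normc_sum _ _ _)) _ => //.
rewrite mulr_sumr; apply: ler_sum => m _.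
rewrite !normcM /toeplitz_deriv -mulrDr; case: ltnP => [lm|ml]; last first.
  by rewrite normc0 !mulr0 mulr_ge0// mulr_ge0// addr_ge0// sqr_ge0.
have -> : (m + 0 == l + k)%N = (m - l == k)%N by apply/eqP/eqP; lia.
case: eqP => [<-|_]; last by rewrite mulr0 mul0r normc0 mul0r !mulr0.
rewrite mulr1 mul1r normcM normcX normc_nat normc_real ger0_norm//.
rewrite mulrCA mulrA mulrC ler_wpM2l ?mulr_ge0 ?exprn_ge0//.
rewrite -subr_ge0.
have := sqr_ge0 (normc (x m) - normc (y l)); lra.
Qed.

(* Within a residue class mod 3 the blocks [bloch_block (2 ^ n)] have disjoint
   supports. *)
Lemma bloch_coef_lacunary (lam : nat -> R) (t : nat) : (forall k, 0 <= lam k) ->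
  exists2 b : nat -> C, bloch_coef 10 b &
    forall n, (n %% 3 == t)%N ->
      4^-1 * Num.sqrt (\sum_(k <- dyadic n.+1) lam k ^+ 2) <=
      \sum_(k <- dyadic n.+1) lam k * normc (b k).
Proof.
move=> lam0.
have q0 n : (0 < 2 ^ n)%N by rewrite expn_gt0.
have /choice[F hF] n := bloch_block (q0 n) lam0.
(* Truncating at [n < k] loses nothing: [k <= n < 2^n] puts [k] outside the support of block [n]. *)
pose b k := \sum_(n < k | (n %% 3 == t)%N) F n k.
have bE M k : (k <= M)%N -> b k = \sum_(n < M | (n %% 3 == t)%N) F n k.
  move=> kM; rewrite /b -!(big_mkord (fun n => n %% 3 == t)%N (fun n => F n k)).
  rewrite [RHS](big_cat_nat (n := k))//= [X in _ + X]big_nat_cond [X in _ + X]big1 ?addr0//.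
  move=> n /andP[/andP[kn _] _]; have [h _ _] := hF n; apply: h.
  by rewrite (leq_trans kn)// ltnW// ltn_expl.
exists b.
  split=> [|r M r01]; first by rewrite /b big_ord0 normc0.
  have /andP[r0 r1] := r01.
  apply: (@bilinear_bound_eq _ _
    (fun l m => \sum_(n < M | (n %% 3 == t)%N) toeplitz_deriv (F n) r l m)).
    move=> l m _ mM; rewrite /toeplitz_deriv; case: ltnP => lm; last by rewrite big1.
    rewrite (bE M); last by rewrite (leq_trans (leq_subr _ _))// ltnW.
    by rewrite mulr_sumr mulr_suml.
  apply: (@bilinear_bound_le _ _ _ (\sum_(n < M | (n %% 3 == t)%N)
     5 * ((2 ^ n)%N%:R * r ^+ (2 ^ n)))); last first.
    by apply: bilinear_bound_sum => n _; have [_ h _] := hF n; exact: h.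
  apply: (@le_trans _ _ (\sum_(n < M) 5 * ((2 ^ n)%N%:R * r ^+ (2 ^ n)))).
    rewrite [leLHS]big_mkcond; apply: ler_sum => n _.
    by case: ifP => // _; rewrite !mulr_ge0// exprn_ge0.
  (* The constant 10 is 5 from each block times 2 from the lacunary sum. *)
  rewrite -mulr_sumr; have := sum_lacunary_le M r01.
  rewrite -(ler_pM2l (x := 5))// => /le_trans; apply.
  by rewrite mulrA -natrM.
move=> n nt; have [_ _] := hF n.
have -> : (2 ^ n + 2 ^ n = 2 ^ n.+1)%N by rewrite addnn -mul2n expnS.
have -> : (4 * 2 ^ n = 2 ^ n.+2)%N by rewrite !expnS mulnA.
move=> /le_trans; apply; rewrite /dyadic big_seq [leRHS]big_seq.
apply: ler_sum => k; rewrite mem_index_iota => /andP[nk kn].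
rewrite le_eqVlt; apply/orP; left; apply/eqP; congr (_ * normc _).
have n_k : (n < k)%N by apply: leq_trans nk; rewrite expnS; have := @ltn_expl 2 n isT; lia.
rewrite /b (bigD1 (Ordinal n_k))//= big1 ?addr0// => i /andP[it inn].
have [h _ _] := hF i; apply: h.
have {}inn : (i : nat) != n by [].
(* Distinct indices of one class differ by at least 3. If [i < n], then [5 * 2^i < 8 * 2^i <= 2^n];
   if [n < i], then [k < 4 * 2^n < 2^i]. *)
have [ilt|nle] := ltnP i n; apply/orP; [right|left].
  have : (i + 3 <= n)%N by move/eqP: it; move/eqP: nt; lia.
  move=> /(leq_pexp2l (isT : 0 < 2)%N); rewrite expnD => h3.
  by apply: leq_trans nk; rewrite expnS; lia.
have : (n + 3 <= i)%N by move/eqP: it; move/eqP: nt; lia.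
move=> /(leq_pexp2l (isT : 0 < 2)%N) => h3; apply: leq_trans h3.
by rewrite expnD; rewrite !expnS in kn; lia.
Qed.

End BlochExamples.

(** * Operators from their sections *)

Section ComplexLimits.
Variable R : realType.
Local Notation C := R[i].
Local Notation Re := complex.Re.
Local Notation Im := complex.Im.

(** The norm of [R[i]^o] is complex valued; through [normc], limits become real ones, open to order
    and squeeze arguments. *)
Lemma cvg_normcP (T : Type) (F : set_system T) {FF : Filter F}
    (f : T -> R[i]^o) (l : R[i]^o) :
  f @ F --> l <-> (fun t => normc (l - f t : C)) @ F --> (0 : R).
Proof.
split=> [/cvgrPdist_lt h|/cvgrPdist_lt h]; apply/cvgrPdist_lt => e e0.
  have e0' : 0 < ((e%:C)%C : C) by rewrite ltcR.
  near=> t; rewrite sub0r normrN ger0_norm ?normc_ge0//.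
  by rewrite -ltcR -norm_normc; near: t; exact: h.
have [e1 e2] : e = ((Re e)%:C)%C /\ 0 < Re e.
  by move: e0; case: (e) => a b; rewrite ltcE /= => /andP[/eqP-> ?].
near=> t; rewrite e1 [X in X < _]norm_normc ltcR.
rewrite -[normc _]ger0_norm ?normc_ge0// -normrN -sub0r.
by near: t; exact: h.
Unshelve. all: by end_near. Qed.

Lemma normc_dist (z w : C) : `|normc z - normc w| <= normc (z - w).
Proof.
rewrite ler_norml; apply/andP; split.
  rewrite lerNl opprB lerBlDr -[normc (z - w)]normcN opprB.
  by apply: le_trans (le_normcD _ _); rewrite subrK.
by rewrite lerBlDr; apply: le_trans (le_normcD _ _); rewrite subrK.
Qed.

Lemma cvg_normc (T : Type) (F : set_system T) {FF : Filter F}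
    (f : T -> R[i]^o) (l : R[i]^o) :
  f @ F --> l -> (fun t => normc (f t)) @ F --> (normc l : R).
Proof.
move=> /cvg_normcP /cvgrPdist_lt h; apply/cvgrPdist_lt => e e0.
near=> t; apply: le_lt_trans (normc_dist _ _) _.
rewrite -[normc _]ger0_norm ?normc_ge0// -normrN -sub0r.
by near: t; exact: h.
Unshelve. all: by end_near. Qed.

Lemma cvg_normc_dist (T : Type) (F : set_system T) {FF : Filter F}
    (f : T -> R[i]^o) (l : R[i]^o) (c : C) :
  f @ F --> l -> (fun t => normc (c - f t : C)) @ F --> (normc (c - l : C) : R).
Proof.
move=> /cvg_normcP /cvgrPdist_lt h; apply/cvgrPdist_lt => e e0.
near=> t; apply: le_lt_trans (normc_dist _ _) _.
rewrite (_ : c - l - (c - f t) = - (l - f t : C)); last by ring.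
rewrite normcN -[normc _]ger0_norm ?normc_ge0// -normrN -sub0r.
by near: t; exact: h.
Unshelve. all: by end_near. Qed.

Lemma cvg_cmulr (T : Type) (F : set_system T) {FF : Filter F}
    (f : T -> R[i]^o) (l : R[i]^o) (c : C) :
  f @ F --> l -> (fun t => c * f t : R[i]^o) @ F --> (c * l : R[i]^o).
Proof.
move=> /cvg_normcP fl; apply/cvg_normcP; rewrite -(mulr0 (normc c)).
under eq_fun do rewrite -mulrBr normcM.
by apply: cvgM => //; exact: cvg_cst.
Qed.

Lemma Re_sum (I : Type) (s : seq I) (P : pred I) (F : I -> C) :
  Re (\sum_(i <- s | P i) F i) = \sum_(i <- s | P i) Re (F i).
Proof. by apply: big_morph => // -[a b] [c d]. Qed.

Lemma Im_sum (I : Type) (s : seq I) (P : pred I) (F : I -> C) :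
  Im (\sum_(i <- s | P i) F i) = \sum_(i <- s | P i) Im (F i).
Proof. by apply: big_morph => // -[a b] [c d]. Qed.

Lemma real_summable_cvg (u : nat -> R) (B : R) :
  (forall n, \sum_(m < n) `|u m| <= B) -> cvgn (series u).
Proof.
move=> uB; apply: normed_cvg; apply: nondecreasing_is_cvgn.
  by apply: (@nondecreasing_series _ (fun m => `|u m|) xpredT 0%N) => m _ _.
by exists B => _ [n _ <-]; have := uB n; rewrite -(big_mkord xpredT (fun m => `|u m|)).
Qed.

Lemma normc_summable_cvg (u : nat -> C) (B : R) :
  (forall n, \sum_(m < n) normc (u m) <= B) ->
  cvgn (series (u : nat -> R[i]^o)).
Proof.
move=> uB.
have cRe : cvgn (series (fun m => Re (u m))).
  apply: (@real_summable_cvg _ B) => n; apply: le_trans (uB n).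
  by apply: ler_sum => m _; exact: normc_re.
have cIm : cvgn (series (fun m => Im (u m))).
  apply: (@real_summable_cvg _ B) => n; apply: le_trans (uB n).
  by apply: ler_sum => m _; exact: normc_im.
set a := limn (series (fun m => Re (u m))) in cRe.
set b := limn (series (fun m => Im (u m))) in cIm.
apply/cvg_ex; exists ((a +i* b)%C : R[i]^o); apply/cvg_normcP.
apply: (@squeeze_cvgr _ _ _ _ (fun=> 0)
  (fun n => `|a - series (fun m => Re (u m)) n| + `|b - series (fun m => Im (u m)) n|)).
- near=> n; rewrite normc_ge0/=; apply: le_trans (normc_le_re_im _) _.
  rewrite /series /= -Re_sum -Im_sum.
  by case: (\sum_(0 <= k < n) u k).
- exact: cvg_cst.
- have dist0 (v : nat -> R) c : v @ \oo --> c -> (fun n => `|c - v n|) @ \oo --> (0 : R).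
    move=> vc; rewrite -(normr0 R) -(subrr c); apply: cvg_norm.
    by apply: cvgB => //; exact: cvg_cst.
  have h := cvgD (dist0 _ _ cRe) (dist0 _ _ cIm); rewrite addr0 in h.
  exact: h.
Unshelve. all: by end_near. Qed.

Lemma cvg_sum_fin (I : Type) (s : seq I) (f : I -> nat -> R) (l : I -> R) :
  (forall i, f i @ \oo --> l i) ->
  (fun n => \sum_(i <- s) f i n) @ \oo --> \sum_(i <- s) l i.
Proof.
move=> h; elim: s => [|i s IH].
  rewrite big_nil; under eq_fun do rewrite big_nil; exact: cvg_cst.
by rewrite big_cons; under eq_fun do rewrite big_cons; apply: cvgD.
Qed.

End ComplexLimits.

Section BoundedSections.
Variable R : realType.
Local Notation C := R[i].

Lemma l2norm_le (x : nat -> C) (B : R) : 0 <= B ->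
  (forall n, \sum_(m < n) normc (x m) ^+ 2 <= B ^+ 2) -> (l2norm x <= B%:E)%E.
Proof.
move=> B0 xB.
have -> : B%:E = sqrte ((B ^+ 2)%:E) by rewrite /= sqrtr_sqr ger0_norm.
rewrite /l2norm lee_sqrt ?lee_fin ?sqr_ge0//.
apply: lime_le; first by apply: is_cvg_nneseries => n _ _; rewrite lee_fin sqr_ge0.
by near=> n; rewrite sumEFin lee_fin big_mkord.
Unshelve. all: by end_near. Qed.

Lemma l2norm_sum_le (x : nat -> C) (B : R) : 0 <= B -> (l2norm x <= B%:E)%E ->
  forall n, \sum_(m < n) normc (x m) ^+ 2 <= B ^+ 2.
Proof.
move=> B0 + n.
have -> : B%:E = sqrte ((B ^+ 2)%:E) by rewrite /= sqrtr_sqr ger0_norm.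
rewrite /l2norm lee_sqrt ?lee_fin ?sqr_ge0// => h.
rewrite -lee_fin -(big_mkord xpredT (fun m => normc (x m) ^+ 2)) -sumEFin.
apply: le_trans h; apply: nneseries_lim_ge => m _ _; by rewrite lee_fin sqr_ge0.
Qed.

(** Tested with [y = conj (D x) / K], the bilinear bound reads [2T/K <= K S + T/K], where [T] and
    [S] are the squared norms of [D x] and [x]. *)
Lemma section_bound M (D : nat -> nat -> C) (K : R) (x : nat -> C) : 0 < K ->
  bilinear_bound M D K ->
  \sum_(l < M) normc (\sum_(m < M) D l m * x m) ^+ 2 <=
  K ^+ 2 * \sum_(m < M) normc (x m) ^+ 2.
Proof.
move=> K0 hD; pose h l := \sum_(m < M) D l m * x m.
have := hD x (fun l => (K^-1%:C)%C * ((h l)^*)%C).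
have -> : \sum_(l < M) \sum_(m < M) (K^-1%:C)%C * ((h l)^*)%C * x m * D l m =
    ((K^-1 * \sum_(l < M) normc (h l) ^+ 2)%:C)%C.
  rewrite mulr_sumr real_complex_sum; apply: eq_bigr => l _.
  rewrite real_complexM sqr_normcJ; move: ((h l)^*)%C => z.
  rewrite /h mulr_suml mulr_sumr.
  by apply: eq_bigr => m _; ring.
under [X in _ <= _ * (_ + X)]eq_bigr do rewrite normcM normc_real normc_conj exprMn.
rewrite normc_real -mulr_sumr -/(h _).
set T := \sum_(l < M) normc (h l) ^+ 2; set S := \sum_(m < M) normc (x m) ^+ 2.
have T0 : 0 <= T by apply: sumr_ge0 => l _; exact: sqr_ge0.
have K1 : 0 <= K^-1 by rewrite invr_ge0 ltW.
rewrite ger0_norm ?mulr_ge0// ger0_norm// => hh.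
rewrite -(ler_pM2l (x := K^-1)) ?invr_gt0//.
have -> : K^-1 * (K ^+ 2 * S) = K * S by field; rewrite gt_eqF.
move: hh; have -> : K * (S + K^-1 ^+ 2 * T) = K * S + K^-1 * T.
  by field; rewrite gt_eqF.
lra.
Qed.

Lemma bilinear_operator (D : imatrix R) (K : R) : 0 < K ->
  (forall M, bilinear_bound M D K) ->
  forall (x : nat -> C) (B : R), 0 <= B -> (l2norm x <= B%:E)%E ->
  (forall j, cvgn (series (fun m => D j m * x m : R[i]^o))) /\
  (l2norm (mxapply D x) <= (K * B)%:E)%E.
Proof.
move=> K0 hD x B B0 /(l2norm_sum_le B0) xB.
have KB0 : 0 <= K * B by rewrite mulr_ge0// ltW.
have row j n : \sum_(m < n) normc (D j m * x m) <= K * B.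
  (* The moduli of [x] times the conjugate phases of row [j] turn each term of that row into its
     modulus, without increasing the l_2 norm. *)
  pose y m := ((normc (x m))%:C)%C * ((D j m)^* / (normc (D j m))%:C)%C : C.
  have DyE m : D j m * y m = ((normc (D j m * x m))%:C)%C.
    rewrite /y mulrCA [D j m * (_ / _)]mulrA -sqr_normcJ normcM [normc (D j m) * _]mulrC [RHS]real_complexM; congr (_ * _).
    have [->|h] := eqVneq (normc (D j m)) 0; first by rewrite expr0n /= mul0r.
    by rewrite real_complexX expr2 mulfK// eq_complex /= negb_and h.
  have yB m : normc (y m) ^+ 2 <= normc (x m) ^+ 2.
    rewrite normcM normc_real ger0_norm ?normc_ge0// exprMn ler_piMr ?sqr_ge0//.
    rewrite exprn_ile1 ?normc_ge0// normcM normcV normc_real normc_conj.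
    rewrite ger0_norm ?normc_ge0//.
    by have [->|h] := eqVneq (normc (D j m)) 0; rewrite ?mul0r ?ler01 ?divff.
  pose N := maxn n j.+1; have jN : (j < N)%N by rewrite leq_maxr.
  apply: (@le_trans _ _ (\sum_(m < N) normc (D j m * x m))).
    rewrite -!(big_mkord xpredT (fun m => normc (D j m * x m))).
    rewrite [leRHS](big_cat_nat (n := n))//= ?leq_maxl// lerDl sumr_ge0// => m _.
    exact: normc_ge0.
  rewrite -[leLHS]ger0_norm ?sumr_ge0// => [|m _]; last exact: normc_ge0.
  rewrite -normc_real real_complex_sum.
  rewrite -(ler_pXn2r (n := 2)) ?nnegrE ?normc_ge0// exprMn.
  under eq_bigr do rewrite -DyE.
  apply: (@le_trans _ _ (\sum_(l < N) normc (\sum_(m < N) D l m * y m) ^+ 2)).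
    rewrite [leRHS](bigD1 (Ordinal jN))//= lerDl sumr_ge0// => l _; exact: sqr_ge0.
  apply: le_trans (section_bound _ K0 (hD N)) _.
  rewrite ler_wpM2l ?sqr_ge0//; apply: le_trans (xB N).
  by apply: ler_sum => m _; exact: yB.
have cv j : cvgn (series (fun m => D j m * x m : R[i]^o)).
  exact: (normc_summable_cvg (row j)).
split=> //; apply: l2norm_le => // P.
(* The first [P] rows are part of the square section of size [n >= P]; [n] tends to infinity with
   [P] fixed. *)
have := @cvg_sum_fin R _ (index_enum 'I_P) (fun l n => normc
   (series (fun m => D l m * x m : R[i]^o) n) ^+ 2)
   (fun l => normc (mxapply D x l) ^+ 2).
move=> /(_ (fun l => _))/cvgr_to_le; apply.
  move=> l; have h := cvg_normc (FF := eventually_filter) (cv l); rewrite expr2.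
  under eq_fun do rewrite expr2; exact: (cvgM h h).
exists P => // n /= Pn; rewrite exprMn.
apply: (@le_trans _ _ (\sum_(l < n) normc (\sum_(m < n) D l m * x m) ^+ 2)); last first.
  by apply: le_trans (section_bound _ K0 (hD n)) _; rewrite ler_wpM2l ?sqr_ge0.
pose f l := normc (\sum_(m < n) D l m * x m) ^+ 2.
rewrite (eq_bigr (fun l : 'I_P => f l)); last first.
  by move=> l _; rewrite /series /= big_mkord.
rewrite -!(big_mkord xpredT f) [leRHS](big_cat_nat (n := P))//= lerDl.
by apply: sumr_ge0 => m _; exact: sqr_ge0.
Qed.

End BoundedSections.

(** * Power series *)

Section ToeplitzBloch.
Variable R : realType.
Local Notation C := R[i].

Definition toeplitz_of (b : nat -> C) : imatrix R :=
  fun j m => if (j <= m)%N then b (m - j)%N else 0.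

Lemma toeplitz_ofP b : toeplitz (toeplitz_of b).
Proof.
split=> [j m mj|k l l']; first by rewrite /toeplitz_of leqNgt mj.
by rewrite /toeplitz_of !leq_addr !addKn.
Qed.

Lemma toeplitz_entry (A : imatrix R) l k :
  toeplitz A -> A l (l + k)%N = A 0%N k.
Proof. by move=> [_ /(_ k l 0%N)]. Qed.

Lemma mxderiv_toeplitz (A : imatrix R) r : toeplitz A ->
  mxderiv A r = toeplitz_deriv (A 0%N) r.
Proof.
move=> tA; apply/funext => j; apply/funext => m; rewrite /mxderiv /toeplitz_deriv.
case: ltnP => [jm|mj]; last first.
  rewrite big_nat big1// => k /andP[k1 _].
  have -> : diag A k j m = 0; last by rewrite mulr0 mul0r.
  by rewrite /diag; case: eqP => //; lia.
rewrite (big_rem (m - j)%N)/=; last by rewrite mem_index_iota; lia.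
rewrite {1}/diag subnKC ?eqxx; last exact: ltnW.
rewrite -{2}(subnKC (ltnW jm)) toeplitz_entry//.
rewrite big_seq big1 ?addr0// => k.
rewrite rem_filter ?iota_uniq// mem_filter /= => /andP[km _].
have -> : diag A k j m = 0; last by rewrite mulr0 mul0r.
by rewrite /diag; case: eqP => // h; rewrite h addKn eqxx in km.
Qed.

Lemma bloch_coef_mxbloch (K : R) (b : nat -> C) : 0 < K -> bloch_coef K b ->
  mxbloch (toeplitz_of b).
Proof.
move=> K0 [b0 hb]; have tb := toeplitz_ofP b.
have b0E : toeplitz_of b 0%N = b.
  by apply/funext => k; rewrite /toeplitz_of leq0n subn0.
have op r : 0 <= r < 1 -> forall (x : nat -> C) (B : R), 0 <= B ->
    (l2norm x <= B%:E)%E ->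
    (forall j, cvgn (series (fun m => mxderiv (toeplitz_of b) r j m * x m : R[i]^o))) /\
    (l2norm (mxapply (mxderiv (toeplitz_of b) r) x) <= (K / (1 - r) * B)%:E)%E.
  move=> r01; rewrite mxderiv_toeplitz// b0E; apply: bilinear_operator.
    by rewrite divr_gt0// subr_gt0; case/andP: r01.
  by move=> M; exact: hb.
split; first by case: tb.
  move=> r r01; exists (K / (1 - r)) => x xfin.
  have l2 : l2norm x = (fine (l2norm x))%:E.
    by rewrite fineK// ge0_fin_numE// /l2norm sqrte_ge0.
  have f0 : 0 <= fine (l2norm x) by rewrite fine_ge0// /l2norm sqrte_ge0.
  rewrite l2 -EFinM; apply: op => //.
  by rewrite -l2.
(* [(1 - r^2) * K / (1 - r) = (1 + r) * K] is at most [2 * K], and the main diagonal adds [K]. *)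
rewrite /mxbloch_norm; apply: (@le_lt_trans _ _ ((2 * K)%:E + K%:E)%E); last first.
  by rewrite -EFinD ltry.
apply: leeD; apply: ge_ereal_sup.
  move=> _ /= [r r01 <-]; have /andP[r0 r1] := r01.
  have r1' : 0 < 1 - r by rewrite subr_gt0.
  have q0 : 0 < 1 - r ^+ 2 by nra.
  apply: (@le_trans _ _ ((1 - r ^+ 2)%:E * (K / (1 - r))%:E)%E).
    rewrite lee_pmul2l ?lte_fin//; apply: ge_ereal_sup => _ /= [x x1 <-].
    by have [_] := op r r01 x 1 ler01 x1; rewrite mulr1.
  rewrite -EFinM lee_fin (_ : (1 - r ^+ 2) * (K / (1 - r)) = (1 + r) * K).
    by rewrite ler_pM2r//; lra.
  by field; rewrite gt_eqF.
by move=> _ /= [l _ <-]; rewrite lee_fin toeplitz_entry// b0E.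
Qed.

End ToeplitzBloch.

(** * Growth of Taylor coefficients and term-by-term differentiation *)

Section PowerSeries.
Variable R : realType.
Local Notation C := R[i].

(** A term is the difference of consecutive partial sums, hence at most 2 once these are within 1 of
    the limit; the earlier terms are added to the bound. *)
Lemma taylor_coef_bound (f : C -> R[i]^o) (a : nat -> C) (s : R) :
  taylor_disc f a -> 0 <= s < 1 -> exists B, forall k, normc (a k) * s ^+ k <= B.
Proof.
move=> fa /andP[s0 s1].
have sn : normc (s%:C)%C = s by rewrite normc_real ger0_norm.
have /fa : normc (s%:C)%C < 1 by rewrite sn.
set l := f _; set S := series _ => /cvg_normcP/cvgrPdist_lt/(_ 1 ltr01) [N _ hN].
have hN' n : (N <= n)%N -> normc (l - S n) < 1.
  by move=> /hN /=; rewrite sub0r normrN ger0_norm ?normc_ge0.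
exists (2 + \sum_(k < N) normc (a k) * s ^+ k) => k.
have [kN|Nk] := ltnP k N.
  rewrite (bigD1 (Ordinal kN))//= addrCA lerDl addr_ge0// sumr_ge0// => i _.
  by rewrite mulr_ge0 ?normc_ge0 ?exprn_ge0.
apply: (@le_trans _ _ 2); last first.
  by rewrite lerDl sumr_ge0// => i _; rewrite mulr_ge0 ?normc_ge0 ?exprn_ge0.
rewrite -[s in s ^+ _]sn -normcX -normcM.
have -> : a k * (s%:C)%C ^+ k = (l - S k) - (l - S k.+1).
  by rewrite /S /series /= big_nat_recr//=; ring.
apply: le_trans (le_normcD _ _) _; rewrite normcN.
by have := hN' _ Nk; have := hN' _ (leqW Nk); lra.
Qed.

(** Induction: the remainder for [k + 1] is [z + h] times that for [k], plus [k z^(k-1) h^2].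
    Multiplying by [rho ^ 2] avoids the exponent [k - 2]. *)
Lemma expr_tangent_bound (z h : C) (rho : R) k : 0 <= rho -> rho <= 1 ->
  normc z <= rho -> normc (z + h) <= rho ->
  rho ^+ 2 * normc ((z + h) ^+ k - z ^+ k - k%:R * z ^+ k.-1 * h) <=
  k%:R ^+ 2 * rho ^+ k * normc h ^+ 2.
Proof.
move=> r0 r1 zr zhr; elim: k => [|k IH].
  by rewrite !expr0 subrr !mul0r subrr normc0 mulr0 expr0n mulr1 mul0r.
have -> : (z + h) ^+ k.+1 - z ^+ k.+1 - k.+1%:R * z ^+ k.+1.-1 * h =
    (z + h) * ((z + h) ^+ k - z ^+ k - k%:R * z ^+ k.-1 * h) +
    k%:R * z ^+ k.-1 * h ^+ 2.
  case: k {IH} => [|k] /=; first by ring.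
  by rewrite !exprS -[in LHS]natr1; ring.
have zk : rho ^+ 2 * normc (k%:R * z ^+ k.-1 * h ^+ 2) <=
    k%:R * rho ^+ k.+1 * normc h ^+ 2.
  rewrite !normcM !normcX normc_nat.
  case: k {IH} => [|k] /=; first by rewrite !mul0r mulr0.
  rewrite (_ : rho ^+ 2 * (k.+1%:R * normc z ^+ k * normc h ^+ 2) =
    k.+1%:R * (rho ^+ 2 * normc z ^+ k) * normc h ^+ 2); last by ring.
  rewrite ler_wpM2r ?sqr_ge0// ler_wpM2l// (exprD rho 2 k).
  by rewrite ler_wpM2l ?exprn_ge0// lerXn2r ?nnegrE ?normc_ge0.
apply: (@le_trans _ _ (rho * (k%:R ^+ 2 * rho ^+ k * normc h ^+ 2) +
   k%:R * rho ^+ k.+1 * normc h ^+ 2)).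
  apply: le_trans (ler_wpM2l _ (le_normcD _ _)) _; first exact: exprn_ge0.
  rewrite mulrDr lerD// normcM mulrCA; apply: ler_pM => //.
  - exact: normc_ge0.
  - by rewrite mulr_ge0 ?exprn_ge0 ?normc_ge0.
rewrite -subr_ge0 -natr1.
have -> : (k%:R + 1) ^+ 2 * rho ^+ k.+1 * normc h ^+ 2 -
    (rho * (k%:R ^+ 2 * rho ^+ k * normc h ^+ 2) +
     k%:R * rho ^+ k.+1 * normc h ^+ 2) =
    (k%:R + 1) * (rho ^+ k.+1 * normc h ^+ 2) by rewrite (exprS rho k); ring.
by rewrite mulr_ge0 ?addr_ge0// mulr_ge0// exprn_ge0// normc_ge0.
Qed.

(** Of the four factors [s^k], one turns [a k] into [B], one for each factor [k] costs
    [1 / (1 - s)], and one is left for the geometric sum; hence [j <= 2]. *)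
Lemma sum_weighted_le (a : nat -> R) (B s : R) (j : nat) : 0 <= s < 1 -> (j <= 2)%N ->
  (forall k, 0 <= a k) -> (forall k, a k * s ^+ k <= B) ->
  forall n, \sum_(k < n) k%:R ^+ j * a k * (s ^+ 4) ^+ k <= B * (1 - s)^-1 ^+ j.+1.
Proof.
move=> s01 j2 a0 aB n; have /andP[s0 s1] := s01.
have is0 : 0 <= (1 - s)^-1 by rewrite invr_ge0 subr_ge0 ltW.
apply: (@le_trans _ _ (\sum_(k < n) B * (1 - s)^-1 ^+ j * s ^+ k)); last first.
  rewrite -mulr_sumr exprSr mulrA ler_wpM2l ?sum_geom_le//.
  by rewrite mulr_ge0 ?exprn_ge0//; have := aB 0%N; rewrite expr0 mulr1; exact: le_trans.
apply: ler_sum => k _.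
have ks : k%:R * s ^+ k <= (1 - s)^-1.
  apply: le_trans (natr_geom_le k s01); rewrite ler_wpM2l//.
  by apply: ler_wiXn2l => //; [exact: ltW|lia].
rewrite (_ : _ * (s ^+ 4) ^+ k =
  (a k * s ^+ k) * (k%:R * s ^+ k) ^+ j * (s ^+ k * s ^+ (k * (2 - j)))); last first.
  rewrite [in RHS](exprMn j k%:R) -!exprM.
  have -> : s ^+ (4 * k) = s ^+ k * s ^+ (k * j) * (s ^+ k * s ^+ (k * (2 - j))).
    by rewrite -!exprD; congr (_ ^+ _); case: j j2 => [|[|[|//]]] _; lia.
  by ring.
have ks0 : 0 <= k%:R * s ^+ k by rewrite mulr_ge0 ?exprn_ge0.
apply: ler_pM.
- by rewrite !mulr_ge0 ?exprn_ge0.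
- by rewrite mulr_ge0 ?exprn_ge0.
- apply: ler_pM => //; rewrite ?mulr_ge0 ?exprn_ge0//.
  by rewrite lerXn2r.
- by rewrite ler_piMr ?exprn_ge0// exprn_ile1// ltW.
Qed.

(** With [1 - s = (1 - t) / 8], Bernoulli's inequality gives
    [s^4 >= 1 - 4 (1 - s) = (1 + t) / 2 > t]. *)
Lemma fourth_root_gap (t : R) : 0 <= t < 1 ->
  exists2 s, 0 <= s < 1 & t < s ^+ 4.
Proof.
move=> /andP[t0 t1]; pose s := 1 - (1 - t) / 8.
exists s; first by apply/andP; split; rewrite /s; lra.
rewrite (_ : s ^+ 4 = (s ^+ 2) ^+ 2); last by rewrite -exprM.
have h : t = 1 - 8 * (1 - s) by rewrite /s; field.
move: h t1; clearbody s; set x := s ^+ 2 => h t1.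
have hx : 2 * s - 1 <= x by have := sqr_ge0 (1 - s); rewrite /x; lra.
have := sqr_ge0 (x - 1); lra.
Qed.

Lemma taylor_deriv_summable (f : C -> R[i]^o) (a : nat -> C) (t : R) :
  taylor_disc f a -> 0 <= t < 1 ->
  exists B, forall n, \sum_(k < n) k%:R * normc (a k) * t ^+ k.-1 <= B.
Proof.
move=> fa t01; have [s s01 ts] := fourth_root_gap t01.
have /andP[t0 t1] := t01.
have rho0 : 0 < s ^+ 4 by apply: le_lt_trans ts.
have [B aB] := taylor_coef_bound fa s01.
exists ((s ^+ 4)^-1 * (B * (1 - s)^-1 ^+ 2)) => n.
have sw := sum_weighted_le s01 (isT : 1 <= 2)%N (fun k => normc_ge0 (a k)) aB n.
apply: le_trans (ler_wpM2l _ sw); last by rewrite invr_ge0 ltW.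
rewrite mulr_sumr; apply: ler_sum => k _; rewrite expr1.
rewrite mulrCA ler_wpM2l ?mulr_ge0 ?normc_ge0//.
rewrite ler_pdivlMl//; case: (k : nat) => [|m] /=.
  by rewrite !expr0 mulr1; case/andP: s01 => s0 s1; rewrite exprn_ile1// ltW.
by rewrite [leRHS]exprS ler_pM2l// lerXn2r ?nnegrE// ltW.
Qed.

(** [expr_tangent_bound], summed against the coefficients at a radius [rho] above [normc z], bounds
    the error of the difference quotient by a constant times [normc h]. *)
Lemma taylor_derive (f : C -> R[i]^o) (a : nat -> C) (z : C) :
  taylor_disc f a -> normc z < 1 ->
  series (fun k => k%:R * a k * z ^+ k.-1 : R[i]^o) @ \oo --> f^`()%classic z.
Proof.
move=> fa z1; have z0 := normc_ge0 z.
have z01 : 0 <= normc z < 1 by rewrite z0.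
have [s s01 zrho] := fourth_root_gap z01.
have /andP[s0 s1] := s01; have [B aB] := taylor_coef_bound fa s01.
set rho := s ^+ 4 in zrho.
have rho0 : 0 < rho by apply: le_lt_trans zrho.
have rho1 : rho < 1 by rewrite /rho exprn_ilt1.
have sw := sum_weighted_le s01 _ (fun k => normc_ge0 (a k)) aB.
have : cvgn (series (fun k => k%:R * a k * z ^+ k.-1 : R[i]^o)).
  have [S hS] := taylor_deriv_summable fa z01.
  apply: (@normc_summable_cvg _ _ S) => n; apply: le_trans (hS n).
  by apply: ler_sum => k _; rewrite !normcM normcX normc_nat.
set G := series _ => /cvg_ex[/= g Gg].
suff -> : f^`()%classic z = g by [].
apply/cvg_lim => //; apply/cvg_normcP.
pose K := rho ^- 2 * (B * (1 - s)^-1 ^+ 3).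
have main (h : C) : h != 0 -> normc h < rho - normc z ->
    normc (g - h^-1 *: (f (h + z) - f z) : C) <= K * normc h.
  move=> h0 hd; have zh : normc (z + h) < rho.
    by apply: le_lt_trans (le_normcD _ _) _; lra.
  have hn : 0 < normc h.
    rewrite lt_def normc_ge0 andbT; apply: contra h0 => /eqP/eq0_normc ->.
    by rewrite eqxx.
  have -> : (g - h^-1 *: (f (h + z) - f z) : C) = - h^-1 * (f (z + h) - f z - h * g).
    rewrite addrC /GRing.scale /=.
    rewrite mulNr [in RHS]mulrBr mulrA mulVf// mul1r opprB (addrC z).
    by rewrite addrC.
  rewrite normcM normcN normcV ler_pdivrMl// mulrCA -expr2.
  have fw : series (fun k => a k * (z + h) ^+ k : R[i]^o) @ \oo --> f (z + h).
    by apply: fa; apply: lt_trans rho1.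
  have fz := fa _ z1.
  have hG := @cvg_cmulr R nat \oo eventually_filter G g h Gg.
  apply: (cvgr_to_le (cvg_normc (cvgB (cvgB fw fz) hG))); near=> n.
  have -> : ((series (fun k => a k * (z + h) ^+ k : R[i]^o) -
      series (fun k => a k * z ^+ k : R[i]^o)) - (fun n => h * G n)) n =
      \sum_(k < n) a k * ((z + h) ^+ k - z ^+ k - k%:R * z ^+ k.-1 * h) :> C.
    rewrite /G /series /= !fctE !big_mkord mulr_sumr -!sumrB.
    by apply: eq_bigr => k _; ring.
  apply: le_trans (normc_sum _ _ _) _.
  rewrite /K -[leRHS]mulrA ler_pdivlMl; last exact: exprn_gt0.
  rewrite [leRHS]mulrC.
  apply: le_trans (ler_wpM2l _ (sw 2 isT n)); last exact: sqr_ge0.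
  rewrite !mulr_sumr; apply: ler_sum => k _; rewrite normcM mulrCA.
  apply: le_trans (ler_wpM2l (normc_ge0 _) (expr_tangent_bound k
    (ltW rho0) (ltW rho1) (ltW zrho) (ltW zh))) _.
  by rewrite le_eqVlt -/rho; apply/orP; left; apply/eqP; ring.
have K0 : 0 <= K.
  apply: mulr_ge0; first by rewrite invr_ge0 exprn_ge0// ltW.
  apply: mulr_ge0.
    by have := aB 0%N; rewrite expr0 mulr1; apply: le_trans; exact: normc_ge0.
  by rewrite exprn_ge0// invr_ge0 subr_ge0 ltW.
apply/cvgrPdist_le => e e0.
pose d := Num.min (rho - normc z) (e / (K + 1)).
have d0 : 0 < d.
  by rewrite lt_min subr_gt0 zrho divr_gt0// ltr_wpDl.
have dC : 0 < ((d%:C)%C : C) by rewrite ltcR.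
exists ((d%:C)%C) => //= h; rewrite /ball_ /= sub0r normrN [X in X < _]norm_normc ltcR lt_min => /andP[hd1 hd2] h0.
rewrite sub0r normrN ger0_norm ?normc_ge0//.
apply: le_trans (main h h0 hd1) _.
move: hd2; rewrite ltr_pdivlMr; last by rewrite ltr_wpDl.
have := normc_ge0 h; nra.
Unshelve. all: by end_near. Qed.

End PowerSeries.

(** * From section bounds to scalar Bloch functions *)

Section ScalarBloch.
Variable R : realType.
Local Notation C := R[i].

Lemma bloch_coefZ (K : R) (z : C) (b : nat -> C) : bloch_coef K b ->
  bloch_coef (normc z * K) (fun k => z * b k).
Proof.
move=> [b0 hb]; split; first by rewrite normcM ler_wpM2l ?normc_ge0.
move=> r M r01; rewrite -mulrA.
apply: bilinear_bound_eq (bilinear_boundZ z (hb r M r01)) => l m _ _.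
by rewrite /toeplitz_deriv; case: ifP => _; rewrite ?mulr0//; ring.
Qed.

Lemma bloch_coef_term (K r : R) (b : nat -> C) k : bloch_coef K b -> 0 <= r < 1 ->
  k%:R * normc (b k) * r ^+ k.-1 <= K / (1 - r).
Proof.
move=> [_ hb] r01; have /andP[r0 _] := r01.
have := hb r k.+1 r01 (fun m => (m == k)%:R) (fun l => (l == 0)%N%:R).
have ord_neq (i j : 'I_k.+1) : j != i -> (j == i :> nat) = false.
  by rewrite -val_eqE => /negbTE.
rewrite (big_only1 ord0)//; last first.
  by move=> l /ord_neq l0 _; rewrite big1// => m _; rewrite l0 !mul0r.
rewrite (big_only1 ord_max)//; last first.
  by move=> m /ord_neq mk _; rewrite mk mulr0 mul0r.
rewrite !eqxx !mul1r /=.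
have -> : normc (toeplitz_deriv b r 0 k) = k%:R * normc (b k) * r ^+ k.-1.
  rewrite /toeplitz_deriv subn0; case: ltnP => [_|].
    by rewrite !normcM normcX normc_nat normc_real ger0_norm.
  by rewrite leqn0 => /eqP ->; rewrite normc0 !mul0r.
rewrite (big_only1 ord_max)//; last first.
  by move=> m /ord_neq mk _; rewrite mk normc0 expr0n.
rewrite (big_only1 ord0)//; last first.
  by move=> l /ord_neq l0 _; rewrite l0 normc0 expr0n.
rewrite !eqxx normc1 expr1n (_ : 1 + 1 = 2)// [leRHS]mulrC ler_pM2l//.
Qed.

Lemma taylor_at0 (f : C -> R[i]^o) (a : nat -> C) : taylor_disc f a -> f 0 = a 0%N.
Proof.
move=> fa; have /fa/cvg_normcP h : normc (0 : C) < 1 by rewrite normc0.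
apply/eqP; rewrite -subr_eq0; apply/eqP/eq0_normc; apply/eqP.
rewrite eq_le normc_ge0 andbT; apply: (cvgr_to_ge h); exists 1%N => //= n n1.
rewrite /series /= -(prednK n1) big_nat_recl// expr0 mulr1 big1 ?addr0// => k _.
by rewrite expr0n /= mulr0.
Qed.

Lemma bloch_coef_taylor (K : R) (b : nat -> C) : 0 < K -> bloch_coef K b ->
  exists f : C -> R[i]^o, taylor_disc f b.
Proof.
move=> K0 hb; exists (fun z => limn (series (fun k => b k * z ^+ k : R[i]^o))).
move=> z z1; have z0 := normc_ge0 z.
(* At a radius strictly between [normc z] and 1 the coefficients are at most [Q / r^k], so a
   geometric series of ratio [normc z / r] dominates. *)
pose r := (1 + normc z) / 2.
have r0 : 0 < r by rewrite /r; lra.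
have r1 : r < 1 by rewrite /r; lra.
have r01 : 0 <= r < 1 by rewrite ltW.
have zr : normc z < r by rewrite /r; lra.
pose Q := K + K / (1 - r).
have K1 : 0 < K / (1 - r) by rewrite divr_gt0// subr_gt0.
have bQ k : normc (b k) * r ^+ k <= Q.
  case: k => [|k].
    by rewrite expr0 mulr1; have [h _] := hb; rewrite /Q; lra.
  rewrite /Q; have := bloch_coef_term k.+1 hb r01 => /=.
  have : normc (b k.+1) * r ^+ k.+1 <= k.+1%:R * normc (b k.+1) * r ^+ k.
    rewrite exprSr mulrA -[leRHS]mulrA [leRHS]mulrC.
    rewrite ler_wpM2l ?mulr_ge0 ?normc_ge0 ?exprn_ge0 ?(ltW r0)//.
    by rewrite (le_trans (ltW r1))// ler1n.
  lra.
suff cz : cvgn (series (fun k => b k * z ^+ k : R[i]^o)) by exact: cz.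
apply: (@normc_summable_cvg _ _ (Q * (1 - normc z / r)^-1)) => n.
have q01 : 0 <= normc z / r < 1.
  by rewrite divr_ge0 ?(ltW r0)//= ltr_pdivrMr// mul1r.
apply: le_trans (ler_wpM2l _ (sum_geom_le n q01)); last by rewrite /Q; lra.
rewrite mulr_sumr; apply: ler_sum => k _; rewrite normcM normcX.
rewrite expr_div_n mulrA [Q * _]mulrC -mulrA mulrC ler_wpM2l ?exprn_ge0//.
by rewrite ler_pdivlMr ?exprn_gt0.
Qed.

Lemma sum_sqr_geom_le (q : R) n : 0 <= q < 1 ->
  \sum_(i < n) (q ^+ i) ^+ 2 <= (1 - q ^+ 2)^-1.
Proof.
move=> /andP[q0 q1]; under eq_bigr do rewrite exprAC.
by apply: sum_geom_le; rewrite exprn_ge0//= exprn_ilt1.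
Qed.

(* The geometric sequence [x m = zeta ^ (m - 1)] is, up to a shift, an
   eigenvector of the upper triangular Toeplitz matrix, with eigenvalue the value
   of the symbol at [zeta]. *)
Lemma bloch_coef_derive (K r : R) (b : nat -> C) (zeta g : C) : 0 < K ->
  bloch_coef K b -> 0 <= r < 1 -> normc zeta < 1 ->
  series (fun k => k%:R * b k * (zeta * (r%:C)%C) ^+ k.-1 : R[i]^o) @ \oo --> (g : R[i]^o) ->
  normc g <= K / (1 - r).
Proof.
move=> K0 [_ hb] r01 q1 Gg; have /andP[r0 r1] := r01.
set q := normc zeta in q1; have q0 : 0 <= q := normc_ge0 _.
set kap := K / (1 - r); have kap0 : 0 < kap by rewrite divr_gt0// subr_gt0.
pose G n := series (fun k => k%:R * b k * (zeta * (r%:C)%C) ^+ k.-1 : R[i]^o) n.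
pose D := toeplitz_deriv b r.
pose x m : C := if m is m'.+1 then zeta ^+ m' else 0.
have q2 : 0 < 1 - q ^+ 2 by rewrite subr_gt0 exprn_ilt1.
have xle n : \sum_(m < n) normc (x m) ^+ 2 <= (1 - q ^+ 2)^-1.
  case: n => [|n]; first by rewrite big_ord0 invr_ge0 ltW.
  rewrite big_ord_recl (_ : x (ord0 : 'I_n.+1) = 0)// normc0 expr0n add0r.
  apply: le_trans (sum_sqr_geom_le n _); last by rewrite q0.
  by apply: ler_sum => m _; rewrite normcX.
(* The shift in [x] matches the exponent [k - 1]: row [l] gives [zeta^l] times a partial sum of the
   derivative series. *)
have DxE n l : (l <= n)%N -> \sum_(m < n) D l m * x m = zeta ^+ l * (G (n - l)%N : C).
  move=> ln; rewrite -(big_mkord xpredT (fun m => D l m * x m)).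
  rewrite (big_cat_nat (n := l))//= big_nat big1 ?add0r; last first.
    by move=> m /andP[_ ml]; rewrite /D /toeplitz_deriv ltnNge ltnW// mul0r.
  rewrite -{1}(add0n l) big_addn /G /series /= mulr_sumr; apply: eq_bigr => k _.
  rewrite /D /toeplitz_deriv addnK; case: k => [|k].
    by rewrite add0n ltnn !mul0r mulr0.
  rewrite -{1}(add0n l) ltn_add2r ltn0Sn addSn /= exprD exprMn; ring.
(* The first [P] rows of ever larger sections give in the limit a geometric sum of
   [q^(2l) * normc g ^ 2]; the factor [1 / (1 - q^2)] on the right cancels against it as [P] tends
   to infinity. *)
have main P : normc g ^+ 2 * (1 - (q ^+ 2) ^+ P) <= kap ^+ 2.
  have h : \sum_(l < P) (q ^+ l * normc g) ^+ 2 <= kap ^+ 2 * (1 - q ^+ 2)^-1.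
    have cv (l : 'I_P) : (fun n => (q ^+ l * normc (G (n - l)%N)) ^+ 2) @ \oo -->
        (q ^+ l * normc g) ^+ 2.
      have Gs : (fun n => normc (G (n - l)%N)) @ \oo --> normc g.
        apply: (cvg_normc (f := fun n => G (n - l)%N)).
        have /= -> := @cvg_centern l _ G (nbhs (g : R[i]^o)); exact: Gg.
      have h1 : (fun n => q ^+ l * normc (G (n - l)%N)) @ \oo --> q ^+ l * normc g.
        by apply: cvgM => //; exact: cvg_cst.
      by under eq_fun do rewrite expr2; rewrite expr2; apply: cvgM.
    have /cvgr_to_le := cvg_sum_fin (s := index_enum 'I_P) cv; apply.
    exists P => // n /= Pn.
    apply: (@le_trans _ _ (\sum_(l < n) normc (\sum_(m < n) D l m * x m) ^+ 2)).
      pose F l := normc (\sum_(m < n) D l m * x m) ^+ 2.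
      rewrite (eq_bigr (fun l : 'I_P => F l)); last first.
        move=> l _; rewrite /F DxE ?normcM ?normcX//.
        by rewrite (leq_trans _ Pn)// ltnW.
      rewrite -!(big_mkord xpredT F) [leRHS](big_cat_nat (n := P))//= lerDl.
      by apply: sumr_ge0 => m _; exact: sqr_ge0.
    apply: le_trans (section_bound _ kap0 (hb r n r01)) _.
    by rewrite ler_wpM2l ?sqr_ge0.
  have /(congr1 -%R) : (q ^+ 2) ^+ P - 1 = (q ^+ 2 - 1) * \sum_(i < P) (q ^+ 2) ^+ i.
    by rewrite subrX1.
  rewrite opprB -mulNr opprB => ->; rewrite mulrCA.
  rewrite -ler_pdivlMl// [leRHS]mulrC; apply: le_trans h.
  rewrite mulr_sumr le_eqVlt; apply/orP; left; apply/eqP.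
  by apply: eq_bigr => l _; rewrite [RHS]exprMn exprAC mulrC.
have q21 : `|q ^+ 2| < 1 by rewrite ger0_norm ?exprn_ge0// exprn_ilt1.
have : (fun P => normc g ^+ 2 * (1 - (q ^+ 2) ^+ P)) @ \oo --> normc g ^+ 2 * (1 - 0).
  apply: cvgM; first exact: cvg_cst.
  by apply: cvgB; [exact: cvg_cst|exact: cvg_expr].
move=> /cvgr_to_le/(_ (nearW _ main)); rewrite subr0 mulr1.
by rewrite ler_pXn2r ?nnegrE ?normc_ge0// ltW.
Qed.

Lemma bloch_coef_norm (K : R) (b : nat -> C) (f : C -> R[i]^o) : 0 < K ->
  bloch_coef K b -> taylor_disc f b -> (bloch_norm f <= (5 * K)%:E)%E.
Proof.
move=> K0 hb fb; rewrite /bloch_norm.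
(* With [r = (1 + |z|) / 2], [1 - |z|^2 = 2 (1 + |z|) (1 - r) <= 4 (1 - r)], which yields [4 K]; the
   value at 0 adds [K]. *)
apply: (@le_trans _ _ ((4 * K)%:E + K%:E)%E); last first.
  by rewrite -EFinD lee_fin; lra.
apply: leeD; last by rewrite lee_fin (taylor_at0 fb); have [] := hb.
apply: ge_ereal_sup => _ /= [z z1 <-]; rewrite lee_fin.
have z0 := normc_ge0 z; pose r := (1 + normc z) / 2.
have r0 : 0 < r by rewrite /r; lra.
have r1 : r < 1 by rewrite /r; lra.
have r01 : 0 <= r < 1 by rewrite ltW.
have rn : normc (r%:C)%C = r by rewrite normc_real ger0_norm// ltW.
have rC : ((r%:C)%C : C) != 0 by rewrite eq_complex /= negb_and gt_eqF.
have zeta1 : normc (z / (r%:C)%C) < 1.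
  by rewrite normcM normcV rn ltr_pdivrMr// mul1r /r; lra.
have := taylor_derive fb z1.
have zE : z = z / (r%:C)%C * (r%:C)%C by rewrite divfK.
rewrite {1}zE => /(bloch_coef_derive K0 hb r01 zeta1).
rewrite ler_pdivlMr ?subr_gt0// => hr.
have -> : (1 - normc z ^+ 2) * normc (f^`()%classic z) =
   2 * (1 + normc z) * (normc (f^`()%classic z) * (1 - r)) by rewrite /r; field.
apply: ler_pM => //; rewrite ?mulr_ge0 ?normc_ge0 ?subr_ge0 ?(ltW r1)//; lra.
Qed.

End ScalarBloch.

(** * Dyadic bounds for coefficients *)

Section CoefficientBounds.
Variable R : realType.
Local Notation C := R[i].

Lemma bernoulli_ineq (h : R) n : 0 <= h <= 1 -> 1 - n%:R * h <= (1 - h) ^+ n.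
Proof.
move=> /andP[h0 h1]; elim: n => [|n IH]; first by rewrite mul0r subr0 expr0.
rewrite exprS; apply: (@le_trans _ _ ((1 - h) * (1 - n%:R * h))); last first.
  by rewrite ler_wpM2l// subr_ge0.
rewrite -natr1 -subr_ge0.
have -> : (1 - h) * (1 - n%:R * h) - (1 - (n%:R + 1) * h) = n%:R * h ^+ 2 by ring.
by rewrite mulr_ge0 ?sqr_ge0.
Qed.

Lemma coef_dyadic_bound (K : R) (a : nat -> C) : 0 <= K -> normc (a 0%N) <= K ->
  (forall r N, 0 <= r < 1 ->
     \sum_(k < N) (k%:R * normc (a k) * r ^+ k.-1) ^+ 2 <= (K / (1 - r ^+ 2)) ^+ 2) ->
  forall n, \sum_(k <- dyadic n) normc (a k) ^+ 2 <= (8 * K) ^+ 2.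
Proof.
move=> K0 a0 ha [|n].
  rewrite /dyadic !big_cons big_nil addr0.
  (* At [r = 0] only the term [k = 1] survives, because [0 ^ 0 = 1]. *)
  have := ha 0 2 ; rewrite lexx ltr01 => /(_ isT).
  rewrite !big_ord_recl big_ord0 /= !mul0r expr0n /= subr0 divr1 expr0 addr0 add0r.
  rewrite mulr1 mul1r => h1.
  have h0 : normc (a 0%N) ^+ 2 <= K ^+ 2 by rewrite lerXn2r ?nnegrE ?normc_ge0.
  rewrite exprMn; have := sqr_ge0 K; lra.
pose Q := (2 ^ n.+1)%N; have Q0 : (0 < Q)%N by rewrite expn_gt0.
have Qr : 0 < Q%:R :> R by rewrite ltr0n.
(* With this [h], Bernoulli's inequality gives [r^(2Q) >= 1/4], so the weights on the block are at
   least [Q / 4], while [K / (1 - r^2) <= 2 Q K]; the quotient is [8 K]. *)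
pose h : R := (2 * Q%:R)^-1; pose r := 1 - h.
have h0 : 0 < h by rewrite invr_gt0 mulr_gt0.
have h1 : h <= 2^-1.
  by rewrite lef_pV2 ?posrE ?mulr_gt0// ler_peMr// ler1n.
have r01 : 0 <= r < 1 by apply/andP; split; rewrite /r; lra.
have /andP[r0 r1] := r01.
have rQ : 2^-1 <= r ^+ Q.
  have h01 : 0 <= h <= 1 by apply/andP; split; lra.
  apply: le_trans (bernoulli_ineq Q h01); rewrite /h.
  have -> : Q%:R * (2 * Q%:R)^-1 = 2^-1 :> R by field; rewrite gt_eqF.
  lra.
have r2Q : 4^-1 <= r ^+ (2 * Q).
  rewrite mulnC exprM; have -> : 4^-1 = 2^-1 ^+ 2 :> R by field.
  by rewrite lerXn2r ?nnegrE ?exprn_ge0.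
have QQ : (2 ^ n.+2 = 2 * Q)%N by rewrite expnS.
have := ha r (2 * Q)%N r01; rewrite /dyadic QQ -/Q => hsum.
have K1 : K / (1 - r ^+ 2) <= K * (2 * Q%:R).
  rewrite ler_wpM2l// -[leRHS]invrK lef_pV2 ?posrE ?invr_gt0 ?mulr_gt0//; last first.
    by rewrite subr_gt0 exprn_ilt1.
  by rewrite -/h /r; nra.
have : (Q%:R / 4) ^+ 2 * \sum_(Q <= k < 2 * Q) normc (a k) ^+ 2 <= (K * (2 * Q%:R)) ^+ 2.
  apply: le_trans (_ : _ <= (K / (1 - r ^+ 2)) ^+ 2) _; last first.
    rewrite lerXn2r ?nnegrE ?mulr_ge0//.
    by rewrite invr_ge0 subr_ge0 exprn_ile1// ltW.
  apply: le_trans hsum; rewrite -(big_mkord xpredT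
    (fun k => (k%:R * normc (a k) * r ^+ k.-1) ^+ 2)).
  rewrite [leRHS](big_cat_nat (n := Q))//=; last by rewrite leq_pmull.
  apply: (@le_trans _ _ (\sum_(Q <= k < 2 * Q)
      (k%:R * normc (a k) * r ^+ k.-1) ^+ 2)); last first.
    by rewrite lerDr sumr_ge0// => k _; exact: sqr_ge0.
  rewrite mulr_sumr big_nat [leRHS]big_nat; apply: ler_sum => k /andP[Qk k2Q].
  rewrite -exprMn lerXn2r ?nnegrE ?mulr_ge0 ?normc_ge0 ?exprn_ge0 ?invr_ge0//.
  rewrite [leRHS]mulrAC ler_wpM2r ?normc_ge0//.
  apply: ler_pM; rewrite ?ler_nat ?invr_ge0//.
  apply: le_trans r2Q _; apply: ler_wiXn2l => //; first exact: ltW.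
  by rewrite (leq_trans (leq_pred _))// ltnW.
rewrite -ler_pdivlMl ?exprn_gt0 ?divr_gt0// => /le_trans; apply.
rewrite le_eqVlt; apply/orP; left; apply/eqP; field; rewrite gt_eqF//.
Qed.

(** Discrete Parseval applies to the partial sums of the derivative on the circle of radius [r];
    these differ from the derivative by at most the tail of an absolutely convergent series, which
    tends to 0. *)
Lemma bloch_norm_coef (f : C -> R[i]^o) (a : nat -> C) (K : R) :
  taylor_disc f a -> (bloch_norm f <= K%:E)%E ->
  normc (a 0%N) <= K /\ forall r N, 0 <= r < 1 ->
    \sum_(k < N) (k%:R * normc (a k) * r ^+ k.-1) ^+ 2 <= (K / (1 - r ^+ 2)) ^+ 2.
Proof.
move=> fa; rewrite /bloch_norm; set s := ereal_sup _ => hK.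
have s_ge z : normc z < 1 ->
    (((1 - normc z ^+ 2) * normc (f^`()%classic z))%:E <= s)%E.
  by move=> z1; apply: ereal_sup_ubound; exists z.
have s0 : (0 <= s)%E.
  apply: le_trans (s_ge 0 _); last by rewrite normc0.
  by rewrite lee_fin normc0 expr0n subr0 mul1r normc_ge0.
have f0 : normc (f 0) <= K by rewrite -lee_fin (le_trans _ hK)// leeDr.
have sK : (s <= K%:E)%E by apply: le_trans hK; rewrite leeDl// lee_fin normc_ge0.
have K0 : 0 <= K by rewrite -lee_fin (le_trans s0).
split=> [|r N r01]; first by rewrite -(taylor_at0 fa).
have /andP[r0 r1] := r01; have q0 : 0 < 1 - r ^+ 2 by rewrite subr_gt0 exprn_ilt1.
pose M := K / (1 - r ^+ 2).
have fM z : normc z = r -> normc (f^`()%classic z) <= M.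
  move=> zr; rewrite /M ler_pdivlMr// mulrC.
  have /s_ge h : normc z < 1 by rewrite zr.
  by rewrite -lee_fin (le_trans _ sK)// -zr.
have [B hB] := taylor_deriv_summable fa r01.
pose c k := k%:R * normc (a k) * r ^+ k.-1.
have c0 k : 0 <= c k by rewrite /c !mulr_ge0 ?normc_ge0 ?exprn_ge0.
have cS : cvgn (series c).
  apply: (@real_summable_cvg _ _ B) => n; apply: le_trans (hB n).
  by apply: ler_sum => k _; rewrite ger0_norm.
have S_nd : nondecreasing_seq (series c).
  by apply: nondecreasing_series => k _ _; exact: c0.
set S := limn (series c) in cS.
have SS n : series c n <= S by exact: nondecreasing_cvgn_le.
pose G n (z : C) : C := \sum_(k < n) k%:R * a k * z ^+ k.-1.
have GM n z : normc z = r -> normc (G n z) <= M + (S - series c n).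
  move=> zr; have z1 : normc z < 1 by rewrite zr.
  rewrite -lerBlDl; apply: (@le_trans _ _ (normc (G n z) - normc (f^`()%classic z))).
    by rewrite lerD2l lerN2 fM.
  apply: le_trans (ler_norm _) (le_trans (normc_dist _ _) _).
  have h := taylor_derive fa z1.
  have /cvgr_to_le := cvg_normc_dist (FF := eventually_filter) (c := G n z) h.
  apply; exists n => // m /= nm.
  apply: le_trans (lerB (SS m) (lexx _)).
  rewrite /series /= /G -(big_mkord xpredT (fun k => k%:R * a k * z ^+ k.-1)).
  rewrite (big_cat_nat (n := n) (p := m))//= opprD addrA subrr sub0r normcN.
  rewrite [X in _ <= X - _](big_cat_nat (n := n))//= addrAC subrr add0r.
  apply: le_trans (normc_sum _ _ _) _; apply: ler_sum => k _.
  by rewrite /c !normcM normcX normc_nat zr.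
have main n : (N <= n)%N -> (0 < n)%N ->
    \sum_(k < N) c k ^+ 2 <= (M + (S - series c n)) ^+ 2.
  move=> Nn n0; have [w pw] := prim_root_complex R n0; have w1 := normc_prim_root pw.
  apply: (@le_trans _ _ (\sum_(k < n) c k ^+ 2)).
    rewrite -!(big_mkord xpredT (fun k => c k ^+ 2)) [leRHS](big_cat_nat (n := N))//=.
    by rewrite lerDl sumr_ge0// => k _; exact: sqr_ge0.
  have nR : 0 < n%:R :> R by rewrite ltr0n.
  rewrite -(ler_pM2l nR).
  pose d k : C := k%:R * a k * (r%:C)%C ^+ k.-1.
  have dc k : normc (d k) = c k.
    by rewrite /d /c !normcM normcX normc_nat normc_real ger0_norm.
  under eq_bigr do rewrite -dc.
  rewrite -(parseval d pw) mulr_natl -[X in _ *+ X](card_ord n) -sumr_const.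
  apply: ler_sum => j _; pose z := (r%:C)%C * w ^+ j.
  have zr : normc z = r by rewrite normcM normcX w1 expr1n mulr1 normc_real ger0_norm.
  have -> : \sum_(k < n) d k * w ^+ (j * k) = w ^+ j * G n z.
    rewrite /G mulr_sumr; apply: eq_bigr => k _; rewrite /d /z.
    case: (k : nat) => [|m]; first by rewrite !mul0r mulr0.
    by rewrite mulnS exprD exprM exprMn; ring.
  rewrite normcM normcX w1 expr1n mul1r lerXn2r ?nnegrE ?normc_ge0//; last exact: GM.
  by rewrite addr_ge0 ?subr_ge0// divr_ge0// ltW.
have : (fun n => (M + (S - series c n)) ^+ 2) @ \oo --> (M + (S - S)) ^+ 2.
  have h : (fun n => M + (S - series c n)) @ \oo --> M + (S - S).
    by apply: cvgD; [exact: cvg_cst|apply: cvgB => //; exact: cvg_cst].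
  by under eq_fun do rewrite expr2; rewrite expr2; apply: cvgM.
rewrite subrr addr0 => /cvgr_to_ge; apply.
exists (maxn N 1) => // n /=; rewrite geq_max => /andP[Nn n0]; exact: main.
Qed.

Lemma mxapply_unit (D : imatrix R) (N : nat) :
  mxapply D (fun m => (m == N)%:R) = fun j => D j N.
Proof.
apply/funext => j; rewrite /mxapply.
suff /cvg_lim h : series (fun m => D j m * (m == N)%:R : R[i]^o) @ \oo -->
    (D j N : R[i]^o) by exact: h.
apply/cvg_normcP.
apply: cvg_near_cst; exists N.+1 => // n /= Nn.
rewrite /series /= (bigD1_seq N) ?mem_index_iota ?iota_uniq//=.
rewrite eqxx mulr1 big1 ?addr0 ?subrr ?normc0// => m /negbTE ->.
by rewrite mulr0.
Qed.

Lemma l2norm_unit (N : nat) : (l2norm (fun m => (m == N)%:R : C) <= 1%:E)%E.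
Proof.
apply: l2norm_le => // n; rewrite expr1n.
have -> : \sum_(m < n) normc ((m == N :> nat)%:R : C) ^+ 2 = (\sum_(m < n) (m == N :> nat))%:R.
  rewrite natr_sum; apply: eq_bigr => m _; rewrite normc_nat.
  by case: eqP; rewrite ?expr1n ?expr0n.
rewrite lern1; elim: n => [|n]; first by rewrite big_ord0.
rewrite big_ord_recr /=; case: (eqVneq n N) => [->|]; last by rewrite addn0.
by rewrite big1// => i _; rewrite ltn_eqF.
Qed.

(** Column [N] of the matrix derivative, read upwards from the diagonal, lists [k a_k r^(k-1)] for
    [k <= N]; as the image of a unit vector, it has l_2 norm at most the operator norm. *)
Lemma mxbloch_coef (A : imatrix R) : toeplitz A -> mxbloch A ->
  exists2 K, 0 < K & normc (A 0%N 0%N) <= K /\ forall r N, 0 <= r < 1 ->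
    \sum_(k < N) (k%:R * normc (A 0%N k) * r ^+ k.-1) ^+ 2 <= (K / (1 - r ^+ 2)) ^+ 2.
Proof.
move=> tA [_ _]; rewrite /mxbloch_norm; set s := ereal_sup _; set t := diagB A 0.
move=> hst.
have l2_ge0 (x : nat -> C) : (0 <= l2norm x)%E by exact: sqrte_ge0.
have op_ge r N : (l2norm (fun j => mxderiv A r j N) <= opnorm (mxderiv A r))%E.
  rewrite -mxapply_unit; apply: ereal_sup_ubound.
  by exists (fun m => (m == N)%:R) => //=; exact: l2norm_unit.
have s_ge r : 0 <= r < 1 -> ((1 - r ^+ 2)%:E * opnorm (mxderiv A r) <= s)%E.
  by move=> r01; apply: ereal_sup_ubound; exists r.
have t_ge : ((normc (A 0%N 0%N))%:E <= t)%E by apply: ereal_sup_ubound; exists 0%N.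
have s0 : (0 <= s)%E.
  apply: le_trans (s_ge 0 _); last by rewrite lexx ltr01.
  rewrite expr0n subr0 mul1e; apply: le_trans (op_ge 0 0%N); exact: l2_ge0.
have t0 : (0 <= t)%E by apply: le_trans t_ge; rewrite lee_fin normc_ge0.
have sfin : s \is a fin_num.
  by rewrite ge0_fin_numE// (le_lt_trans _ hst)// leeDl.
have tfin : t \is a fin_num.
  by rewrite ge0_fin_numE// (le_lt_trans _ hst)// leeDr.
pose K := fine s + fine t + 1.
have fs0 : 0 <= fine s by rewrite fine_ge0.
have ft0 : 0 <= fine t by rewrite fine_ge0.
exists K; first by rewrite /K; lra.
split.
  by move: t_ge; rewrite -(fineK tfin) lee_fin /K; lra.
move=> r N r01; have /andP[r0 r1] := r01.
have q0 : 0 < 1 - r ^+ 2 by rewrite subr_gt0 exprn_ilt1.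
pose c k := (k%:R * normc (A 0%N k) * r ^+ k.-1) ^+ 2.
have KB : 0 <= K / (1 - r ^+ 2) by rewrite divr_ge0 ?(ltW q0)// /K; lra.
have lN : (l2norm (fun j => mxderiv A r j N) <= (K / (1 - r ^+ 2))%:E)%E.
  apply: le_trans (op_ge r N) _; rewrite EFinM muleC lee_pdivlMl//.
  apply: le_trans (s_ge r r01) _; rewrite -(fineK sfin) lee_fin /K; lra.
have := l2norm_sum_le KB lN N; apply: le_trans.
apply: (@le_trans _ _ (\sum_(k < N.+1) c k)).
  by rewrite big_ord_recr /= lerDl sqr_ge0.
rewrite big_ord_recl {1}/c !mul0r expr0n add0r.
rewrite (reindex_inj rev_ord_inj) /=.
apply: ler_sum => j _; rewrite mxderiv_toeplitz// /toeplitz_deriv ltn_ord.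
have -> : bump 0 (N - j.+1) = (N - j)%N by rewrite /bump leq0n add1n subnSK.
by rewrite /c !normcM normcX normc_nat normc_real ger0_norm.
Qed.

End CoefficientBounds.

(** * Duality with the dyadic mixed norm *)

Section KotheDual.
Variable R : realType.
Local Notation C := R[i].

Lemma sum_dyadic (V : nmodType) (F : nat -> V) n :
  \sum_(0 <= m < n.+1) \sum_(k <- dyadic m) F k = \sum_(0 <= k < 2 ^ n.+1) F k.
Proof.
elim: n => [|n IH].
  by rewrite big_nat1 expn1.
by rewrite big_nat_recr//= IH [RHS](big_cat_nat (n := (2 ^ n.+1)%N))//= leq_exp2l.
Qed.

(** All terms are nonnegative, so the double sum may be regrouped by diagonals through
    [(k, l) -> (l, l + k)]. *)
Lemma toeplitz_pairing (A B : imatrix R) : toeplitz B ->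
  \esum_(jm in [set: nat * nat]) (normc (A jm.1 jm.2 * B jm.1 jm.2))%:E =
  (\sum_(0 <= k <oo) diagS1 A k * (normc (B 0%N k))%:E)%E.
Proof.
move=> tB; have [uB _] := tB.
pose h (p : nat * nat) := (normc (A p.1 p.2 * B p.1 p.2))%:E.
have h0 p : (0 <= h p)%E by rewrite lee_fin normc_ge0.
pose T := [set p : nat * nat | (p.1 <= p.2)%N].
transitivity (\esum_(p in T) h p).
  rewrite [RHS]esum_mkcond; apply: eq_esum => p _.
  case: ifPn => // /negP; rewrite inE /T /= => /negP; rewrite -ltnNge => lt_p.
  by rewrite uB// mulr0 normc0.
transitivity (\sum_(0 <= k <oo) \sum_(0 <= l <oo) h (l, (l + k)%N))%E; last first.
  apply: eq_eseriesr => k _; rewrite muleC /diagS1 -nneseriesZl; last first.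
    by move=> l _; rewrite lee_fin normc_ge0.
  apply: eq_eseriesr => l _.
  by rewrite /h normcM (toeplitz_entry _ _ tB) EFinM muleC.
rewrite nneseries_esumT => [|k]; last exact: nneseries_ge0.
under eq_esum do rewrite nneseries_esumT//.
rewrite esum_esum//.
rewrite (@reindex_esum _ _ _ (setT `*`` (fun=> setT)) T
  (fun p : nat * nat => (p.2, (p.2 + p.1)%N)))//.
split=> [p _|[k l] [k' l'] _ _ [-> /addnI ->]//|[j m] /= jm].
  by rewrite /T /= leq_addr.
by exists ((m - j)%N, j) => //=; rewrite subnKC.
Qed.

Lemma sum_CauchySchwarz (s : seq nat) (x a : nat -> R) (B : R) : 0 <= B ->
  \sum_(k <- s) a k ^+ 2 <= B ^+ 2 ->
  \sum_(k <- s) x k * a k <= B * Num.sqrt (\sum_(k <- s) x k ^+ 2).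
Proof.
move=> B0 aB; set X := Num.sqrt _.
have X0 : 0 <= X := sqrtr_ge0 _.
have XE : X ^+ 2 = \sum_(k <- s) x k ^+ 2.
  by rewrite sqr_sqrtr// sumr_ge0// => k _; exact: sqr_ge0.
(* The choice [u = B], [v = X] balances both terms; [X = 0] and [B = 0], where division by [B * X]
   fails, are treated apart. *)
have key (u v : R) : 2 * (u * v) * \sum_(k <- s) x k * a k <=
    u ^+ 2 * X ^+ 2 + v ^+ 2 * B ^+ 2.
  apply: (@le_trans _ _ (u ^+ 2 * X ^+ 2 + v ^+ 2 * \sum_(k <- s) a k ^+ 2)).
    rewrite XE !mulr_sumr -big_split /=; apply: ler_sum => k _.
    rewrite -subr_ge0; have := sqr_ge0 (u * x k - v * a k); nra.
  by rewrite lerD2l ler_wpM2l ?sqr_ge0.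
have [X00|Xn0] := eqVneq X 0.
  have xk0 : {in s, forall k, x k = 0}.
    move=> k ks; apply/eqP; rewrite -sqrf_eq0; move: XE; rewrite X00 expr0n => /esym/eqP.
    by rewrite psumr_eq0 => [/allP/(_ k ks)|i _]; rewrite ?sqr_ge0.
  rewrite X00 mulr0 big_seq big1// => k ks.
  by rewrite xk0// mul0r.
have [B00|Bn0] := eqVneq B 0.
  have ak0 : {in s, forall k, a k = 0}.
    move=> k ks; apply/eqP; rewrite -sqrf_eq0.
    have : \sum_(k <- s) a k ^+ 2 == 0.
      rewrite eq_le sumr_ge0 ?andbT => [|i _]; last exact: sqr_ge0.
      by apply: le_trans aB _; rewrite B00 expr0n.
    by rewrite psumr_eq0 => [/allP/(_ k ks)|i _]; rewrite ?sqr_ge0.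
  rewrite B00 mul0r big_seq big1// => k ks.
  by rewrite ak0// mulr0.
have := key B X; have XB : 0 < B * X by rewrite mulr_gt0// lt_def ?Xn0 ?Bn0.
rewrite (_ : B ^+ 2 * X ^+ 2 + X ^+ 2 * B ^+ 2 = 2 * (B * X) * (B * X)); last by ring.
by rewrite ler_pM2l// mulr_gt0.
Qed.

(** If some [x k] is infinite, so is the right-hand side, because [B > 0]; otherwise all values are
    real. *)
Lemma ereal_CauchySchwarz (s : seq nat) (x : nat -> \bar R) (a : nat -> R) (B : R) :
  0 < B -> (forall k, (0 <= x k)%E) -> \sum_(k <- s) a k ^+ 2 <= B ^+ 2 ->
  (\sum_(k <- s) x k * (a k)%:E <= B%:E * sqrte (\sum_(k <- s) x k ^+ 2))%E.
Proof.
move=> B0 x0 aB; have [/hasP[k ks /eqP xk]|/hasPn xfin] := boolP (has (fun k => x k == +oo%E) s).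
  have -> : (\sum_(k <- s) x k ^+ 2 = +oo)%E.
    have xx0 i : (0 <= x i ^+ 2)%E by rewrite expe2 mule_ge0.
    have h : (+oo <= \sum_(k <- s) x k ^+ 2)%E.
      apply: (@le_trans _ _ (x k ^+ 2)%E); first by rewrite xk expe2 mulyy.
      by rewrite (big_rem k ks) leeDl// sume_ge0// => i _; exact: xx0.
    by apply/eqP; rewrite eq_le leey.
  by rewrite /= gt0_muley ?leey ?lte_fin.
pose y k := fine (x k).
have xE k : k \in s -> x k = (y k)%:E.
  by move=> ks; rewrite fineK// ge0_fin_numE// lt_neqAle leey andbT xfin.
have -> : (\sum_(k <- s) x k * (a k)%:E = (\sum_(k <- s) y k * a k)%:E)%E.
  rewrite -sumEFin big_seq [RHS]big_seq; apply: eq_bigr => k ks.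
  by rewrite xE.
have -> : (\sum_(k <- s) x k ^+ 2 = (\sum_(k <- s) y k ^+ 2)%:E)%E.
  rewrite -sumEFin big_seq [RHS]big_seq; apply: eq_bigr => k ks.
  by rewrite xE.
by rewrite /= -EFinM lee_fin; apply: sum_CauchySchwarz => //; exact: ltW.
Qed.

Lemma dyadic_duality (x : nat -> \bar R) (a : nat -> R) (B : R) :
  0 < B -> (forall k, (0 <= x k)%E) -> (forall k, 0 <= a k) ->
  (forall n, \sum_(k <- dyadic n) a k ^+ 2 <= B ^+ 2) ->
  (\sum_(0 <= k <oo) x k * (a k)%:E <=
   B%:E * \sum_(0 <= n <oo) sqrte (\sum_(k <- dyadic n) x k ^+ 2))%E.
Proof.
move=> B0 x0 a0 aB.
have xa0 k : (0 <= x k * (a k)%:E)%E by rewrite mule_ge0 ?lee_fin.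
rewrite -nneseriesZl => [|n _]; last exact: sqrte_ge0.
apply: lime_le; first by apply: is_cvg_nneseries.
near=> N.
(* The first [N] indices lie in the blocks up to [N], as [N <= 2^(N+1)]. *)
apply: (@le_trans _ _ (\sum_(0 <= k < 2 ^ N.+1) x k * (a k)%:E)%E).
  rewrite [leRHS](big_cat_nat (n := N))//=; last first.
    by rewrite (leq_trans (leqnSn _))// ltnW// ltn_expl.
  by rewrite leeDl// sume_ge0.
have <- := @sum_dyadic (\bar R) (fun k => x k * (a k)%:E)%E N.
apply: le_trans (nneseries_lim_ge N.+1 _); last first.
  by move=> n _ _; rewrite mule_ge0 ?sqrte_ge0// lee_fin ltW.
by apply: lee_sum => n _; exact: ereal_CauchySchwarz.
Unshelve. all: by end_near. Qed.

End KotheDual.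

(** * Lower bound by test sequences, and the conclusion *)

Section BlochTests.
Variable R : realType.
Local Notation C := R[i].

Definition diag_pairing (A : imatrix R) (b : nat -> C) : \bar R :=
  (\sum_(0 <= k <oo) diagS1 A k * (normc (b k))%:E)%E.

Lemma diagS1_ge0 (A : imatrix R) k : (0 <= diagS1 A k)%E.
Proof. by apply: nneseries_ge0 => l _ _; rewrite lee_fin normc_ge0. Qed.

Lemma diag_pairing_ge0 A b : (0 <= diag_pairing A b)%E.
Proof.
by apply: nneseries_ge0 => k _ _; rewrite mule_ge0 ?diagS1_ge0 ?lee_fin ?normc_ge0.
Qed.

Lemma diag_pairing_monomial A k :
  (diagS1 A k <= diag_pairing A (fun i => (i == k)%:R))%E.
Proof.
apply: le_trans (nneseries_lim_ge k.+1 _); last first.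
  by move=> i _ _; rewrite mule_ge0 ?diagS1_ge0 ?lee_fin ?normc_ge0.
rewrite big_nat_recr//= eqxx normc1 mule1 leeDr// sume_ge0// => i _.
by rewrite mule_ge0 ?diagS1_ge0 ?lee_fin ?normc_ge0.
Qed.

(** Dividing [b] by [5 K] puts the function with these coefficients into the unit ball over which
    [sigma] is a supremum. *)
Lemma diag_pairing_sigma (A : imatrix R) (K : R) (b : nat -> C) : 0 < K ->
  bloch_coef K b -> (diag_pairing A b <= (5 * K)%:E * sigma A)%E.
Proof.
move=> K0 hb; have K5 : 0 < 5 * K by rewrite mulr_gt0.
pose z : C := ((5 * K)^-1%:C)%C.
have zn : normc z = (5 * K)^-1 by rewrite normc_real ger0_norm// invr_ge0 ltW.
have zK : normc z * K = 5^-1 by rewrite zn; field; rewrite gt_eqF.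
have := bloch_coefZ z hb; rewrite zK => hb'.
have i5 : 0 < 5^-1 :> R by rewrite invr_gt0.
have [f fb] := bloch_coef_taylor i5 hb'.
have f1 := bloch_coef_norm i5 hb' fb; rewrite divff// in f1.
apply: (@le_trans _ _ ((5 * K)%:E * diag_pairing A (fun k => z * b k)%R)%E); last first.
  rewrite lee_wpmul2l ?lee_fin ?(ltW K5)//; apply: ereal_sup_ubound.
  by exists f, (fun k => z * b k); split.
rewrite /diag_pairing -nneseriesZl => [|k _]; last first.
  by rewrite mule_ge0 ?diagS1_ge0 ?lee_fin ?normc_ge0.
apply: lee_nneseries => k _.
  by rewrite mule_ge0 ?diagS1_ge0 ?lee_fin ?normc_ge0.
by rewrite muleCA -EFinM normcM zn mulrA mulfV ?mul1r// gt_eqF.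
Qed.

(** One test sequence per residue class: block [n + 1] is charged to the class of [n] mod 3 with a
    factor 4, and block 0 to [lam 0] and [lam 1]. *)
Lemma dyadic_norm_le_tests (lam : nat -> R) : (forall k, 0 <= lam k) ->
  exists2 b : nat -> nat -> C, forall t, bloch_coef 10 (b t) &
  forall N, \sum_(0 <= n < N.+1) Num.sqrt (\sum_(k <- dyadic n) lam k ^+ 2) <=
    lam 0%N + lam 1%N +
    4 * \sum_(t < 3) \sum_(0 <= k < 2 ^ N.+1) lam k * normc (b t k).
Proof.
move=> lam0.
have /choice[b hb] t : exists b : nat -> C, bloch_coef 10 b /\
    forall n, (n %% 3 == t)%N ->
      4^-1 * Num.sqrt (\sum_(k <- dyadic n.+1) lam k ^+ 2) <=
      \sum_(k <- dyadic n.+1) lam k * normc (b k).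
  by have [b h1 h2] := bloch_coef_lacunary t lam0; exists b.
exists b => [t|N]; first by have [] := hb t.
have g0 t k : 0 <= lam k * normc (b t k) by rewrite mulr_ge0 ?normc_ge0.
rewrite big_nat_recl//; apply: lerD.
  rewrite /dyadic !big_cons big_nil addr0.
  rewrite -[leRHS]ger0_norm ?addr_ge0// -sqrtr_sqr ler_wsqrtr// sqrrD.
  by rewrite addrAC lerDl mulrn_wge0// mulr_ge0.
rewrite -ler_pdivrMl//.
apply: (@le_trans _ _ (\sum_(0 <= n < N) \sum_(t < 3)
    \sum_(k <- dyadic n.+1) lam k * normc (b t k))).
  rewrite mulr_sumr; apply: ler_sum => n _.
  have n3 : (n %% 3 < 3)%N by rewrite ltn_mod.
  have [_ /(_ n (eqxx _)) h] := hb (n %% 3)%N; apply: le_trans h _.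
  rewrite [leRHS](bigD1 (Ordinal n3))//= lerDl sumr_ge0// => t _.
  by apply: sumr_ge0 => k _.
rewrite exchange_big; apply: ler_sum => t _.
rewrite -(sum_dyadic (fun k => lam k * normc (b t k))) [leRHS]big_nat_recl// lerDr.
by apply: sumr_ge0 => k _.
Qed.

Lemma MS1_norm_le_tests (A : imatrix R) : (forall k, (diagS1 A k < +oo)%E) ->
  exists2 b : nat -> nat -> C, forall t, bloch_coef 10 (b t) &
  (MS1_norm A <= diagS1 A 0 + diagS1 A 1 +
     4%:E * (diag_pairing A (b 0%N) + diag_pairing A (b 1%N) + diag_pairing A (b 2%N)))%E.
Proof.
move=> Afin; pose lam k := fine (diagS1 A k).
have lamE k : diagS1 A k = (lam k)%:E.
  by rewrite fineK// ge0_fin_numE// diagS1_ge0.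
have lam0 k : 0 <= lam k by rewrite fine_ge0// diagS1_ge0.
have [b hb hN] := dyadic_norm_le_tests lam0; exists b => //.
have sqE n : sqrte (\sum_(k <- dyadic n) diagS1 A k ^+ 2)%E =
    (Num.sqrt (\sum_(k <- dyadic n) lam k ^+ 2))%:E.
  have -> : (\sum_(k <- dyadic n) diagS1 A k ^+ 2 = (\sum_(k <- dyadic n) lam k ^+ 2)%:E)%E.
    by rewrite -sumEFin; apply: eq_bigr => k _; rewrite lamE.
  by [].
have part t N : ((\sum_(0 <= k < N) lam k * normc (b t k))%:E <= diag_pairing A (b t))%E.
  apply: le_trans (nneseries_lim_ge N _); last first.
    by move=> k _ _; rewrite mule_ge0 ?diagS1_ge0 ?lee_fin ?normc_ge0.
  rewrite -sumEFin le_eqVlt; apply/orP; left; apply/eqP.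
  by apply: eq_bigr => k _; rewrite lamE EFinM.
apply: lime_le; first by apply: is_cvg_nneseries => n _ _; exact: sqrte_ge0.
exists 1%N => // -[//|N] _ /=.
under eq_bigr do rewrite sqE.
rewrite sumEFin; apply: (@le_trans _ _ (lam 0%N + lam 1%N +
    4 * \sum_(t < 3) \sum_(0 <= k < 2 ^ N.+1) lam k * normc (b t k))%:E).
  by rewrite lee_fin.
rewrite !lamE EFinD EFinM leeD2l// lee_wpmul2l ?lee_fin//.
by rewrite !big_ord_recl big_ord0 addr0 addrA !EFinD !leeD.
Qed.

End BlochTests.

Theorem theoremC (R : realType) :
  (forall A : imatrix R, upper_triangular A ->
     ((forall B : imatrix R, toeplitz B -> mxbloch B ->
         (\esum_(jm in [set: nat * nat])
            (normc (A jm.1 jm.2 * B jm.1 jm.2))%:E < +oo)%E)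
      <-> MS1 A))
  /\
  (exists c C : R, [/\ 0 < c, 0 < C &
     forall A : imatrix R, upper_triangular A ->
       (c%:E * MS1_norm A <= sigma A)%E /\
       (sigma A <= C%:E * MS1_norm A)%E]).
Proof.
(* This estimate yields both the implication from (b) to (a) and the upper constant, its hypothesis
   being common to matrices and functions. *)
have dual (A : imatrix R) (a : nat -> R[i]) (K : R) : 0 < K ->
    normc (a 0%N) <= K ->
    (forall r N, 0 <= r < 1 -> \sum_(k < N) (k%:R * normc (a k) * r ^+ k.-1) ^+ 2
       <= (K / (1 - r ^+ 2)) ^+ 2) ->
    (diag_pairing A a <= (8 * K)%:E * MS1_norm A)%E.
  move=> K0 a0 ha; apply: dyadic_duality.
  - by rewrite mulr_gt0.
  - by move=> k; exact: diagS1_ge0.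
  - by move=> k; exact: normc_ge0.
  - by apply: coef_dyadic_bound => //; exact: ltW.
split=> [A uA|]; first split=> [hA|[_ Afin] B tB mB].
- have test K b : 0 < K -> bloch_coef K b -> (diag_pairing A b < +oo)%E.
    move=> K0 hb; have := hA _ (toeplitz_ofP b) (bloch_coef_mxbloch K0 hb).
    rewrite toeplitz_pairing; last exact: toeplitz_ofP.
    rewrite (_ : toeplitz_of b 0%N = b)//.
    by apply/funext => k; rewrite /toeplitz_of subn0.
  (* Monomials first show that every diagonal is summable, so that real test sequences adapted to
     [A] exist. *)
  split=> //; have Afin k : (diagS1 A k < +oo)%E.
    by apply: le_lt_trans (diag_pairing_monomial A k) (test _ _ ltr01 (bloch_coef_monomial R k)).
  have [b hb hle] := MS1_norm_le_tests Afin.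
  have tb t : (diag_pairing A (b t) < +oo)%E by exact: (test 10).
  apply: le_lt_trans hle _; rewrite lte_add_pinfty ?lte_add_pinfty//.
  by rewrite lte_mul_pinfty ?lee_fin// !lte_add_pinfty.
- rewrite toeplitz_pairing//; have [K K0 [a0 ha]] := mxbloch_coef tB mB.
  apply: le_lt_trans (dual A _ K K0 a0 ha) _.
  by rewrite lte_mul_pinfty// lee_fin mulr_ge0// ltW.
(* [610 = 5 + 5 + 4 * 3 * 50]: two monomials with [K = 1] and three test sequences with [K = 10],
   each costing [5 K]. The 8 is [8 * K] at [K = 1]. *)
- exists 610^-1, 8; split=> // A uA; split.
    have s0 : (0 <= sigma A)%E.
      have : (0 <= (5 * 1)%:E * sigma A)%E.
        apply: le_trans (diag_pairing_sigma A ltr01 (bloch_coef_monomial R 0)).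
        exact: diag_pairing_ge0.
      by rewrite pmule_rge0 ?lte_fin// mulr1.
    have [->|sfin] := eqVneq (sigma A) +oo%E; first exact: leey.
    have mono k : (diagS1 A k <= 5%:E * sigma A)%E.
      apply: le_trans (diag_pairing_monomial A k) _; rewrite -[5]mulr1.
      exact: (diag_pairing_sigma A ltr01 (bloch_coef_monomial R k)).
    have sE : sigma A = (fine (sigma A))%:E.
      by rewrite fineK// ge0_fin_numE// lt_neqAle sfin leey.
    have Afin k : (diagS1 A k < +oo)%E.
      by apply: le_lt_trans (mono k) _; rewrite sE -EFinM ltry.
    have [b hb hle] := MS1_norm_le_tests Afin.
    have pb t : (diag_pairing A (b t) <= (5 * 10)%:E * sigma A)%E.
      exact: diag_pairing_sigma.
    rewrite lee_pdivrMl//; apply: le_trans hle _.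
    apply: (@le_trans _ _ (5%:E * sigma A + 5%:E * sigma A + 4%:E *
       ((5 * 10)%:E * sigma A + (5 * 10)%:E * sigma A + (5 * 10)%:E * sigma A))%E).
      apply: leeD; first exact: leeD.
      by rewrite lee_wpmul2l ?lee_fin// !leeD.
    by rewrite sE -!EFinM -!EFinD lee_fin; lra.
  apply: ge_ereal_sup => _ [f [a [fa f1 ->]]].
  have [a0 ha] := bloch_norm_coef fa f1.
  by have := dual A a 1 ltr01 a0 ha; rewrite mulr1.
Qed.
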